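(* Suppose $n$ is an even integer with $n\geq t_1+t_2+t_3$, and put $K=k_1+k_2+k_3$, $N=\tfrac{n+1}{2}$, $\mathscr M=\mathscr M_n(x_1)\cap\mathscr M_n(x_2)\cap\mathscr M_n(x_3)$. Let $W_0=E_{n-t_1-t_2-t_3}(k_1+N,\,k_2+N,\,k_3+N)$, $A=O_{t_1-1}(K+n+1,\,k_3,\,k_2)$, $B=O_{t_2-1}(k_3,\,K+n+1,\,k_1)$, $C=O_{t_3-1}(k_2,\,k_1,\,K+n+1)$. Then, as $\mathfrak{BI}$-modules: (i) $\mathscr M\cong W_0\oplus W_0$; (ii) $\mathscr M_n/\mathscr M_n(x_1)\cong A\oplus A$; (iii) $\mathscr M_n/\mathscr M_n(x_2)\cong B\oplus B$; (iv) $\mathscr M_n/\mathscr M_n(x_3)\cong C\oplus C$; (v) $\mathscr M_n(x_1)/\mathscr M\cong B\oplus B\oplus C\oplus C$; (vi) $\mathscr M_n(x_2)/\mathscr M\cong A\oplus A\oplus C\oplus C$; (vii) $\mathscr M_n(x_3)/\mathscr M\cong A\oplus A\oplus B\oplus B$. Moreover, $W_0,A,B,C$ are irreducible.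
   Context: Fix real numbers $k_1,k_2,k_3$. For $i=1,2,3$ let $R_i$ be the operator on functions on $\mathbb R^3$ replacing $x_i$ by $-x_i$, and $T_if=\frac{\partial f}{\partial x_i}+k_i\frac{f-R_if}{x_i}$ (Dunkl operators). Let $\sigma_1=\begin{pmatrix}0&1\\1&0\end{pmatrix}$, $\sigma_2=\begin{pmatrix}0&-\sqrt{-1}\\ \sqrt{-1}&0\end{pmatrix}$, $\sigma_3=\begin{pmatrix}1&0\\0&-1\end{pmatrix}$, and let $e_i$ act on $\mathbb C^2$ by $\sigma_i$. Tensor products are over $\mathbb R$; $\mathbb R[\cdots]_m$ denotes homogeneous polynomials of degree $m$. Let $\mathbf D=e_1\otimes T_1+e_2\otimes T_2+e_3\otimes T_3$ and $\mathscr M_n=\ker(\mathbf D|_{\mathbb C^2\otimes\mathbb R[x_1,x_2,x_3]_n})$. For $i=1,2,3$ set $t_i=-2k_i$ if $2k_i$ is an odd negative integer, and $t_i=\infty$ otherwise. For $i=1,2,3$, $\mathscr M_n(x_i)=\mathscr M_n\cap\bigoplus_{j=t_i}^n\mathbb C^2\otimes(x_i^j\cdot\mathbb R[x_p,x_q]_{n-j})$ where $\{p,q\}=\{1,2,3\}\setminus\{i\}$ (it is $\{0\}$ if $n<t_i$); it is a $\mathfrak{BI}$-submodule of $\mathscr M_n$. $\mathfrak{BI}$ is the unital associative $\mathbb C$-algebra generated by $X,Y,Z$ with relations saying that $\{X,Y\}-Z$, $\{Y,Z\}-X$, $\{Z,X\}-Y$ commute with $X,Y,Z$ ($\{A,B\}=AB+BA$).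 $\mathscr M_n$ is a $\mathfrak{BI}$-module via $X=(\sqrt{-1}\,e_1\otimes(x_3T_2-x_2T_3)+\tfrac12)R_2R_3+k_2R_3+k_3R_2$, $Y=(\sqrt{-1}\,e_2\otimes(x_1T_3-x_3T_1)+\tfrac12)R_1R_3+k_3R_1+k_1R_3$, $Z=(\sqrt{-1}\,e_3\otimes(x_2T_1-x_1T_2)+\tfrac12)R_1R_2+k_1R_2+k_2R_1$, operators composed right to left, $R_i$ acting on the polynomial factor. For $a,b,c\in\mathbb C$ and an integer $d\geq0$, let $\theta_i=\frac{(-1)^i(2a-d+2i)}{2}$, $\theta^*_i=\frac{(-1)^i(2b-d+2i)}{2}$ ($0\le i\le d$). For odd $d$, $E_d(a,b,c)$ is the $\mathfrak{BI}$-module $\mathbb C^{d+1}$ in which, w.r.t. a basis $v_0,\dots,v_d$, $X$ acts by the lower bidiagonal matrix with diagonal $(\theta_i)$ and subdiagonal entries $1$, $Y$ by the upper bidiagonal matrix with diagonal $(\theta^*_i)$ and superdiagonal $(\varphi_1,\dots,\varphi_d)$ with $\varphi_i=i(d-i+1)$ ($i$ even), $\varphi_i=c^2-\frac{(2a+2b-d+2i-1)^2}{4}$ ($i$ odd), and $Z=\{X,Y\}-\big(c^2-a^2-b^2+\frac{(d+1)^2}{4}\big)$. For even $d$, $O_d(a,b,c)$ is defined in the same way but with $\varphi_i=\frac{i(d+1-2i-2a-2b-2c)}{2}$ ($i$ even), $\varphi_i=\frac{(i-d-1)(d+1-2i-2a-2b+2c)}{2}$ ($i$ odd), and $Z=\{X,Y\}-(2ab-c(d+1))$.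 *)

(* Defs.v *)
From HB Require Import structures.
From mathcomp Require Import all_boot all_order all_algebra.
From mathcomp Require Import reals.
From mathcomp Require Import complex.
From mathcomp Require Import mpoly.

Set Implicit Arguments.
Unset Strict Implicit.
Unset Printing Implicit Defensive.

Import Order.TTheory GRing.Theory Num.Theory.
Local Open Scope ring_scope.
Local Open Scope complex_scope.
Local Open Scope ring_scope.

Section Dunkl.
Variable R : realType.
Local Notation C := (R[i]).
Local Notation P := {mpoly C[3]}.

(* C^2 (x)_R R[x1,x2,x3] = pairs of complex polynomials *)
Definition V := (P * P)%type.

Definition vadd (u v : V) : V := (u.1 + v.1, u.2 + v.2).
Definition vscale (c : C) (u : V) : V := (c *: u.1, c *: u.2).
Definition vzero : V := (0, 0).
Definition vmap (f : P -> P) (u : V) : V := (f u.1, f u.2).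

(* Pauli matrices acting on the C^2 factor *)
Definition sig1 (u : V) : V := (u.2, u.1).
Definition sig2 (u : V) : V := (- 'i%C *: u.2, 'i%C *: u.1).
Definition sig3 (u : V) : V := (u.1, - u.2).

Definition is_homog (n : nat) (p : P) : bool :=
  all (fun m : 'X_{1..3} => mdeg m == n) (msupp p).

Definition refl (i : 'I_3) (p : P) : P :=
  p \mPo [tuple (if j == i then - 'X_j else 'X_j) | j < 3].

(* division by x_i (exact on polynomials divisible by x_i, such as f - R_i f) *)
Definition divX (i : 'I_3) (q : P) : P :=
  \sum_(m <- msupp q | (0 < m i)%N) q@_m *: 'X_[(m - mnm1 i)%MM].

Definition dunkl (k : 'I_3 -> R) (i : 'I_3) (p : P) : P :=
  mderiv i p + (k i)%:C *: divX i (p - refl i p).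

Definition mulX (i : 'I_3) (p : P) : P := 'X_i * p.

Definition Dirac (k : 'I_3 -> R) (u : V) : V :=
  vadd (sig1 (vmap (dunkl k 0) u))
    (vadd (sig2 (vmap (dunkl k 1) u)) (sig3 (vmap (dunkl k 2) u))).

Definition angmom (k : 'I_3 -> R) (a b : 'I_3) (p : P) : P :=
  mulX a (dunkl k b p) - mulX b (dunkl k a p).

Definition Xpart (sig : V -> V) (k : 'I_3 -> R) (a b : 'I_3) (w : V) : V :=
  vadd (vscale 'i%C (sig (vmap (angmom k a b) w))) (vscale (2%:R)^-1 w).

Definition opX (k : 'I_3 -> R) (u : V) : V :=
  vadd (Xpart sig1 k 2 1 (vmap (refl 1) (vmap (refl 2) u)))
    (vadd (vscale (k 1)%:C (vmap (refl 2) u)) (vscale (k 2)%:C (vmap (refl 1) u))).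

Definition opY (k : 'I_3 -> R) (u : V) : V :=
  vadd (Xpart sig2 k 0 2 (vmap (refl 0) (vmap (refl 2) u)))
    (vadd (vscale (k 2)%:C (vmap (refl 0) u)) (vscale (k 0)%:C (vmap (refl 2) u))).

Definition opZ (k : 'I_3 -> R) (u : V) : V :=
  vadd (Xpart sig3 k 1 0 (vmap (refl 0) (vmap (refl 1) u)))
    (vadd (vscale (k 0)%:C (vmap (refl 1) u)) (vscale (k 1)%:C (vmap (refl 0) u))).

Definition Mn (k : 'I_3 -> R) (n : nat) (u : V) : Prop :=
  is_homog n u.1 /\ is_homog n u.2 /\ Dirac k u = vzero.

Definition divisible_from (i : 'I_3) (t : nat) (p : P) : bool :=
  all (fun m : 'X_{1..3} => (t <= m i)%N) (msupp p).

Definition Mnx (k : 'I_3 -> R) (n : nat) (i : 'I_3) (t : nat) (u : V) : Prop :=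
  Mn k n u /\ divisible_from i t u.1 /\ divisible_from i t u.2.

(* t_i = t (finite): 2 k_i is an odd negative integer and t = -2 k_i *)
Definition is_t (ki : R) (t : nat) : Prop := odd t /\ 2%:R * ki = - t%:R.

(* finite-dimensional BI-modules given by matrices (acting on column vectors) *)
Record bimod := BIMod {
  bdim : nat;
  bX : 'M[C]_bdim;
  bY : 'M[C]_bdim;
  bZ : 'M[C]_bdim }.

Definition bidiagX (d : nat) (theta : nat -> C) : 'M[C]_d.+1 :=
  \matrix_(r, s) (if r == s then theta (r : nat)
                  else if (r : nat) == s.+1 then 1 else 0).

Definition bidiagY (d : nat) (thetas : nat -> C) (phi : nat -> C) : 'M[C]_d.+1 :=
  \matrix_(r, s) (if r == s then thetas (r : nat)
                  else if (s : nat) == r.+1 then phi (s : nat) else 0).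

Definition anticomm (d : nat) (A B : 'M[C]_d.+1) := A *m B + B *m A.

Definition theta_ (d : nat) (a : C) (i : nat) : C :=
  (-1) ^+ i * (2%:R * a - d%:R + 2%:R * i%:R) / 2%:R.

(* E_d(a,b,c), for odd d *)
Definition Emod (d : nat) (a b c : C) : bimod :=
  let X := bidiagX d (theta_ d a) in
  let Y := bidiagY d (theta_ d b)
     (fun i => if ~~ odd i then i%:R * (d%:R - i%:R + 1)
               else c ^+ 2 - (2%:R * a + 2%:R * b - d%:R + 2%:R * i%:R - 1) ^+ 2
                              / 4%:R) in
  BIMod X Y (anticomm X Y
    - (c ^+ 2 - a ^+ 2 - b ^+ 2 + (d%:R + 1) ^+ 2 / 4%:R)%:M).

(* O_d(a,b,c), for even d *)
Definition Omod (d : nat) (a b c : C) : bimod :=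
  let X := bidiagX d (theta_ d a) in
  let Y := bidiagY d (theta_ d b)
     (fun i => if ~~ odd i
               then i%:R * (d%:R + 1 - 2%:R * i%:R - 2%:R * a - 2%:R * b - 2%:R * c)
                    / 2%:R
               else (i%:R - d%:R - 1)
                    * (d%:R + 1 - 2%:R * i%:R - 2%:R * a - 2%:R * b + 2%:R * c)
                    / 2%:R) in
  BIMod X Y (anticomm X Y - (2%:R * a * b - c * (d%:R + 1))%:M).

Definition dsum (M N : bimod) : bimod :=
  BIMod (block_mx (bX M) 0 0 (bX N)) (block_mx (bY M) 0 0 (bY N))
        (block_mx (bZ M) 0 0 (bZ N)).

(* U/S is isomorphic to W as BI-modules: there is a C-linear map on U,
   intertwining X,Y,Z, onto W, whose kernel on U is exactly S
   (first isomorphism theorem). *)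
Definition quot_iso (k : 'I_3 -> R) (U S : V -> Prop) (W : bimod) : Prop :=
  exists f : V -> 'cV[C]_(bdim W),
    [/\ (forall c u v, U u -> U v -> f (vadd (vscale c u) v) = c *: f u + f v),
        (forall u, U u -> [/\ f (opX k u) = bX W *m f u,
                              f (opY k u) = bY W *m f u &
                              f (opZ k u) = bZ W *m f u]),
        (forall w, exists u, U u /\ f u = w)
      & (forall u, U u -> (f u = 0 <-> S u))].

Definition bimod_irreducible (W : bimod) : Prop :=
  (0 < bdim W)%N /\
  forall S : 'cV[C]_(bdim W) -> Prop,
    S 0 ->
    (forall c v w, S v -> S w -> S (c *: v + w)) ->
    (forall v, S v -> S (bX W *m v)) ->
    (forall v, S v -> S (bY W *m v)) ->
    (forall v, S v -> S (bZ W *m v)) ->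
    (forall v, S v -> v = 0) \/ (forall v, S v).

Definition kvec (k1 k2 k3 : R) (i : 'I_3) : R := nth 0 [:: k1; k2; k3] i.

End Dunkl.

(* Main.v *)
Require Import Defs.
From HB Require Import structures.
From mathcomp Require Import all_boot all_order all_algebra.
From mathcomp Require Import reals.
From mathcomp Require Import complex.
From mathcomp Require Import mpoly.
From mathcomp Require Import ring zify.

Import Order.TTheory GRing.Theory Num.Theory.
Local Open Scope complex_scope.
Local Open Scope ring_scope.

(** Let [w a b c] in C^2 be the coefficient of x1^a x2^b x3^c in an element of
    M_n, and [j]_i := j + k_i (1 - (-1)^j), which vanishes exactly at j = 0 and
    j = t_i.  Then D u = 0 is a recurrence between neighbouring [w a b c] with
    coefficients [j]_i: it forces w = 0 as soon as two exponents lie below their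
    t's, it determines u in M_n(x_r) from the slice where the exponent of x_r is
    t_r, and any such slice extends to an element of M_n(x_r).

    For a permutation (p, q, r) of (1, 2, 3), the operators attached to p and q
    act on that slice, after twisting by powers of sigma_r, by opposite
    bidiagonal scalar matrices P and Q.  The exponents of x_p below t_p give
    M_n / M_n(x_p), those between t_p and n - t_q - t_r give the intersection M,
    each occurring twice because of the factor C^2.

    Such a segment module is irreducible: Q + eps R - c shifts eigenvectors of P
    to neighbouring ones, and as P^2 + Q^2 + R^2 is scalar, shifting forth and
    back is multiplication by an explicit nonzero product.  A left eigenvector
    m_0 of Y for theta*_d and m_(i+1) := m_i (X - theta_(d-i)) satisfy the
    relations of the rows of E_d or O_d, which gives a nonzero intertwiner from
    the irreducible segment module, hence an isomorphism. *)

Set Implicit Arguments.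
Unset Strict Implicit.
Unset Printing Implicit Defensive.

(** Parity shapes the computation: on the slice the exponents of x_p and x_q add up to n - t_r,
    which is odd, so signs and Dunkl numbers attached to x_q are functions of the exponent of x_p
    alone. The segment modules are an intermediate model. In their own basis P and Q are bidiagonal,
    but X, Y, Z are matched with P, Q, R in a different order for A, B and C, and the left
    eigenvector needed for B and W_0 is in general no basis row. Comparing matrices directly is
    therefore awkward; a chain of left vectors needs only one eigenvector, the cubic relation
    between X and Y, and a value that is not an eigenvalue of Y, which forces the chain to stop.
    Claims (v) to (vii) come from a sharper form of (ii) to (iv): every class of M_n / M_n(x_p) has
    a representative lying in both M_n(x_q) and M_n(x_r). Two of the three quotient maps, restricted
    to the remaining submodule, can thus be prescribed independently. *)

Section Split.
Variable F : numFieldType.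
Variable d : nat.
Implicit Types (pd qd phi : nat -> F).

(** * Bidiagonal matrices acting on row vectors *)

Definition rawP pd : 'M[F]_d.+1 :=
  \matrix_(i, j) (if i == j then pd i else if (j : nat) == i.+1 then 1 else 0).
Definition rawQ qd phi : 'M[F]_d.+1 :=
  \matrix_(i, j) (if i == j then qd i else if (i : nat) == j.+1 then phi i else 0).
(** Indexed by [nat], so that the row past the end is 0 and the bidiagonal relations need no
    separate case at the last index. *)
Definition unit_row (j : nat) : 'rV[F]_d.+1 := \row_s ((s : nat) == j)%:R.

Lemma unit_rowE (j : 'I_d.+1) m (A : 'M_(d.+1, m)) : unit_row j *m A = row j A.
Proof.
apply/rowP => s; rewrite !mxE (bigD1 j) //= mxE eqxx mul1r big1 ?addr0 //.
by move=> i /negbTE ne; rewrite mxE -(inj_eq val_inj) /= in ne *; rewrite ne mul0r.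
Qed.

Lemma unit_row0 j : (d < j)%N -> unit_row j = 0.
Proof.
move=> lt; apply/rowP => s; rewrite !mxE; case: eqP => // e.
by have := ltn_ord s; rewrite e ltnS leqNgt lt.
Qed.

Lemma mx_rowP m (A B : 'M[F]_(d.+1, m)) :
  (forall j, unit_row j *m A = unit_row j *m B) -> A = B.
Proof. by move=> h; apply/row_matrixP => i; rewrite -!unit_rowE h. Qed.

Lemma unit_rowP pd j :
  unit_row j *m rawP pd = pd j *: unit_row j + unit_row j.+1.
Proof.
have [lt|ge] := ltnP j d.+1; last by rewrite !unit_row0 ?mul0mx ?scaler0 ?addr0 // ltnW.
rewrite (unit_rowE (Ordinal lt)); apply/rowP => s; rewrite !mxE -!(inj_eq val_inj) /=.
rewrite [(s : nat) == j]eq_sym; case: (j =P s) => [->|ne]; last by rewrite mulr0 add0r; case: eqP.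
by rewrite ltn_eqF // mulr1 addr0.
Qed.

Lemma unit_rowQ0 qd phi : unit_row 0 *m rawQ qd phi = qd 0 *: unit_row 0.
Proof.
rewrite (unit_rowE ord0); apply/rowP => s; rewrite !mxE -!(inj_eq val_inj) /=.
by rewrite [(s : nat) == _]eq_sym; case: eqP => _; rewrite ?mulr1 ?mulr0.
Qed.

(** At j = d the left side is 0, and the relation says exactly that [phi d.+1 = 0]. *)
Lemma unit_rowQ qd phi j : phi d.+1 = 0 ->
  unit_row j.+1 *m rawQ qd phi = qd j.+1 *: unit_row j.+1 + phi j.+1 *: unit_row j.
Proof.
move=> ph; have [lt|] := ltnP j.+1 d.+1; last first.
  rewrite leq_eqVlt => /orP[/eqP <-|lt]; last by rewrite !unit_row0 ?mul0mx ?scaler0 ?addr0 // ltnW.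
  by rewrite ph scale0r unit_row0 // mul0mx scaler0 addr0.
rewrite (unit_rowE (Ordinal lt)); apply/rowP => s; rewrite !mxE -!(inj_eq val_inj) /=.
rewrite [(s : nat) == j.+1]eq_sym; case: (j.+1 =P s) => [<-|ne].
  by rewrite eqn_leq ltnn mulr0 addr0 mulr1.
by rewrite mulr0 add0r eqSS [j == s]eq_sym; case: eqP => e; rewrite ?mulr1 ?mulr0.
Qed.

End Split.

(** * Segment modules *)

Section SegmentModule.
Variable F : numFieldType.
Variables (kp kq kr n : F).

(* Here [a] is the exponent of x_p, and [seg_phi a] = [a]_p [n - t_r - a + 1]_q
   for t_r = -2 kr odd and n even. *)
Definition seg_pd (a : nat) : F := (-1) ^+ a * (n + 2^-1 - a%:R + kq + kr).
Definition seg_qd (a : nat) : F := - (-1) ^+ a * (2^-1 + a%:R + kp - kr).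
Definition seg_phi (a : nat) : F :=
  if odd a then (a%:R + 2 * kp) * (n + 1 - a%:R + 2 * kr + 2 * kq)
  else a%:R * (n + 1 - a%:R + 2 * kr).

(** The K + n + 1 of the statement; in the central values below it plays the part of a fourth
    parameter beside [kp], [kq], [kr]. *)
Definition k_top := kp + kq + kr + n + 1.
(* The scalars by which {Q, R} - P, {R, P} - Q and {P, Q} - R act. *)
Definition kap_p := 2 * kq * kr + 2 * kp * k_top.
Definition kap_q := 2 * kr * kp + 2 * kq * k_top.
Definition kap_r := 2 * kp * kq + 2 * kr * k_top.
(** The scalar by which X^2 + Y^2 + Z^2, a central element of the algebra, acts. *)
Definition casimir := k_top ^+ 2 + kp ^+ 2 + kq ^+ 2 + kr ^+ 2 - 4^-1.

Variables (d a0 : nat).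
Definition segP : 'M[F]_d.+1 := rawP d (fun j => seg_pd (a0 + j)).
Definition segQ : 'M[F]_d.+1 := rawQ d (fun j => seg_qd (a0 + j)) (fun j => seg_phi (a0 + j)).
Definition segR : 'M[F]_d.+1 := segP *m segQ + segQ *m segP - kap_r%:M.

Hypothesis phi_lo : seg_phi a0 = 0.
Hypothesis phi_hi : seg_phi (a0 + d.+1) = 0.

Let e := @unit_row F d.
Let eP j : e j *m segP = seg_pd (a0 + j) *: e j + e j.+1.
Proof. exact: unit_rowP. Qed.
Let eQ j : e j.+1 *m segQ = seg_qd (a0 + j.+1) *: e j.+1 + seg_phi (a0 + j.+1) *: e j.
Proof. exact: unit_rowQ. Qed.
Let eQ0 : e 0 *m segQ = seg_qd a0 *: e 0.
Proof. by rewrite /segQ unit_rowQ0 addn0. Qed.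


(** Consecutive diagonal entries of P, and likewise of Q, add up to a sign. Hence the off-diagonal
    entries of R are those of P and Q up to sign. *)
Let eR j : e j.+1 *m segR = ((-1) ^+ (a0 + j.+1) * (kq - kp) - 2^-1) *: e j.+1 + (-1) ^+ (a0 + j.+1) *: e j.+2
    - ((-1) ^+ (a0 + j.+1) * seg_phi (a0 + j.+1)) *: e j.
Proof.
rewrite /segR mulmxBr mulmxDr !mulmxA eP eQ !mulmxDl -!scalemxAl !eP !eQ.
rewrite mul_mx_scalar !addnS; move: (a0 + j)%N => a.
apply/rowP => s; rewrite !mxE /seg_phi /seg_pd /seg_qd /kap_r /k_top !exprS -[(-1) ^+ a]signr_odd /= -!natr1.
case: (odd a) => /=; field => //.
Qed.


(** The diagonal entry of R is 2 pd qd + phi_a + phi_(a+1) - [kap_r]; this is its closed form,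
    solved for phi_(a+1). It serves row 0, where phi_a is 0. *)
Lemma seg_phi_step a : seg_phi a.+1
   = kap_r - 2^-1 + (-1) ^+ a * (kq - kp) - 2 * seg_pd a * seg_qd a - seg_phi a.
Proof.
rewrite /seg_phi /seg_pd /seg_qd /kap_r /k_top -[(-1) ^+ a]signr_odd /= -natr1.
by case: odd => /=; field.
Qed.

Let eR0 : e 0 *m segR = ((-1) ^+ a0 * (kq - kp) - 2^-1) *: e 0 + (-1) ^+ a0 *: e 1.
Proof.
rewrite /segR mulmxBr mulmxDr !mulmxA eP eQ0 !mulmxDl -!scalemxAl !eP !eQ eQ0.
rewrite mul_mx_scalar !addnS addn0 seg_phi_step phi_lo; move: (a0) => a.
rewrite /seg_pd /seg_qd /kap_r /k_top !exprS -[(-1) ^+ a]signr_odd.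
apply/rowP => s; rewrite !mxE /= -!natr1.
by case: (odd a) => /=; field.
Qed.

Lemma segP_row j : e j *m segP = seg_pd (a0 + j) *: e j + e j.+1.
Proof. exact: eP. Qed.
Lemma segQ_row0 : e 0 *m segQ = seg_qd a0 *: e 0.
Proof. exact: eQ0. Qed.
Lemma segQ_row j : e j.+1 *m segQ = seg_qd (a0 + j.+1) *: e j.+1 + seg_phi (a0 + j.+1) *: e j.
Proof. exact: eQ. Qed.
Lemma segR_row0 : e 0 *m segR = ((-1) ^+ a0 * (kq - kp) - 2^-1) *: e 0 + (-1) ^+ a0 *: e 1.
Proof. exact: eR0. Qed.
Lemma segR_row j : e j.+1 *m segR = ((-1) ^+ (a0 + j.+1) * (kq - kp) - 2^-1) *: e j.+1 + (-1) ^+ (a0 + j.+1) *: e j.+2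
    - ((-1) ^+ (a0 + j.+1) * seg_phi (a0 + j.+1)) *: e j.
Proof. exact: eR. Qed.
Lemma segPQ : segP *m segQ + segQ *m segP = segR + kap_r%:M.
Proof. by rewrite /segR subrK. Qed.

Lemma segQR : segQ *m segR + segR *m segQ = segP + kap_p%:M.
Proof.
move: segR eR eR0 => SR fR fR0.
have E := (fR0, eQ0, fR, eQ, eP, mulmxDl, mulmxBl, mulNmx, mul_mx_scalar, =^~ scalemxAl).
(* Row 0 satisfies the polynomial identity only up to this multiple of [seg_phi a0], which vanishes.
   Row 1 is also separate, because it reaches [e 0]. *)
have Z : (- (-1) ^+ a0 * seg_phi a0) *: e 0 = 0 by rewrite phi_lo ?mulr0 ?oppr0 scale0r.
apply: mx_rowP => -[|[|j]]; rewrite !mulmxDr !mulmxA !E !addnS ?addn0;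
  [rewrite -[LHS]addr0 -[X in _ + X]Z; move: (a0) => a|move: (a0) => a|move: (a0 + j)%N => a];
  rewrite /seg_phi /seg_pd /seg_qd /kap_p /kap_r /k_top !exprS -[(-1) ^+ a]signr_odd;
  apply/rowP => s; rewrite !mxE /= -!natr1; by case: (odd a) => /=; field.
Qed.

Lemma segPR : segP *m segR + segR *m segP = segQ + kap_q%:M.
Proof.
move: segR eR eR0 => SR fR fR0.
have E := (fR0, eQ0, fR, eQ, eP, mulmxDl, mulmxBl, mulNmx, mul_mx_scalar, =^~ scalemxAl).
have Z : (- (-1) ^+ a0 * seg_phi a0) *: e 0 = 0 by rewrite phi_lo ?mulr0 ?oppr0 scale0r.
apply: mx_rowP => -[|[|j]]; rewrite !mulmxDr !mulmxA !E !addnS ?addn0;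
  [rewrite -[LHS]addr0 -[X in _ + X]Z; move: (a0) => a|move: (a0) => a|move: (a0 + j)%N => a];
  rewrite /seg_phi /seg_pd /seg_qd /kap_q /kap_r /k_top !exprS -[(-1) ^+ a]signr_odd;
  apply/rowP => s; rewrite !mxE /= -!natr1; by case: (odd a) => /=; field.
Qed.

Lemma seg_casimir : segP *m segP + segQ *m segQ + segR *m segR = casimir%:M.
Proof.
move: segR eR eR0 => SR fR fR0.
have E := (fR0, eQ0, fR, eQ, eP, mulmxDl, mulmxBl, mulNmx, mul_mx_scalar, =^~ scalemxAl).
have Z : (seg_phi a0) *: e 0 = 0 by rewrite phi_lo ?mulr0 ?oppr0 scale0r.
apply: mx_rowP => -[|[|j]]; rewrite !mulmxDr !mulmxA !E !addnS ?addn0;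
  [rewrite -[LHS]addr0 -[X in _ + X]Z; move: (a0) => a|move: (a0) => a|move: (a0 + j)%N => a];
  rewrite /seg_phi /seg_pd /seg_qd /casimir /kap_r /k_top !exprS -[(-1) ^+ a]signr_odd;
  apply/rowP => s; rewrite !mxE /= -!natr1; by case: (odd a) => /=; field.
Qed.

End SegmentModule.

(* {P, Q + eps R} = eps (Q + eps R) + scalar, so [w'] is an eigenvector; it is
   nonzero since (Q + eps R)^2 = cas - P^2 + eps (P + kp). *)
Lemma ladder (F : fieldType) (D : nat) (P Q R : 'M[F]_D) (kp kq kr cas eps th : F) (w : 'cV[F]_D) :
    P *m Q + Q *m P = R + kr%:M -> Q *m R + R *m Q = P + kp%:M ->
    P *m R + R *m P = Q + kq%:M -> P *m P + Q *m Q + R *m R = cas%:M ->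
    eps * eps = 1 -> 2 * th - eps != 0 ->
    let c := (kr + eps * kq) / (2 * th - eps) in
    cas - th ^+ 2 + eps * th + eps * kp - c ^+ 2 != 0 ->
    w != 0 -> P *m w = th *: w ->
    let w' := Q *m w + eps *: (R *m w) - c *: w in
    w' != 0 /\ P *m w' = (eps - th) *: w'.
Proof.
move=> PQ QR PR CA ee nz c nzF nw Pw w'.
have PQw : P *m (Q *m w) = R *m w + kr *: w - th *: (Q *m w).
  by rewrite -[kr *: w]mul_scalar_mx -mulmxDl -PQ mulmxDl -!mulmxA Pw -scalemxAr addrK.
have PRw : P *m (R *m w) = Q *m w + kq *: w - th *: (R *m w).
  by rewrite -[kq *: w]mul_scalar_mx -mulmxDl -PR mulmxDl -!mulmxA Pw -scalemxAr addrK.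
have Qcw : c * (2 * th - eps) = kr + eps * kq by rewrite divfK.
split; last first.
  have kE : kr = c * (2 * th - eps) - eps * kq by rewrite Qcw addrK.
  rewrite /w' mulmxBr mulmxDr -!scalemxAr PQw PRw Pw kE.
  move: (Q *m w) (R *m w) => a b; apply/colP => s; rewrite !mxE.
  apply/eqP; rewrite -subr_eq0; apply/eqP.
  transitivity ((1 - eps * eps) * b s 0); last by rewrite ee subrr mul0r.
  by ring.
apply/negP => /eqP w'0.
have QRw : (Q + eps *: R) *m w = c *: w.
  by apply/eqP; rewrite -subr_eq0 mulmxDl -scalemxAl; apply/eqP.
have sq : (Q + eps *: R) *m ((Q + eps *: R) *m w) = c ^+ 2 *: w.
  by rewrite QRw -scalemxAr QRw scalerA.
have sq2 : (Q + eps *: R) *m ((Q + eps *: R) *m w) = (cas - th ^+ 2 + eps * th + eps * kp) *: w.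
  have -> : (Q + eps *: R) *m ((Q + eps *: R) *m w) = (cas%:M - P *m P + eps *: (P + kp%:M)) *m w.
    rewrite -CA -QR mulmxA; congr (_ *m w).
    rewrite mulmxDl !mulmxDr -!scalemxAl -!scalemxAr scalerA ee scale1r.
    by apply/matrixP => i j; rewrite !mxE; ring.
  rewrite !mulmxDl mulNmx -!scalemxAl mulmxDl !mul_scalar_mx -mulmxA Pw -scalemxAr Pw.
  by apply/colP => s; rewrite !mxE; ring.
have : (cas - th ^+ 2 + eps * th + eps * kp - c ^+ 2) *: w = 0.
  by rewrite scalerBl -sq2 sq subrr.
by move/eqP; rewrite scaler_eq0 (negbTE nzF) (negbTE nw).
Qed.

(** * Irreducibility of segment modules *)

Section Irreducible.
Variable F : numFieldType.
Variables (kp kq kr n : F) (d a0 : nat).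
Local Notation P := (segP kq kr n d a0).
Local Notation Q := (segQ kp kq kr n d a0).
Local Notation R := (segR kp kq kr n d a0).
Local Notation pd := (fun j => seg_pd kq kr n (a0 + j)).
Local Notation phi := (fun j => seg_phi kp kq kr n (a0 + j)).

(* The scalar of the shift from [a + 1] to [a] and back, times
   (n - a + kq + kr)^2. *)
Definition seg_gap (a : nat) : F :=
  if odd a then (a%:R + 1) * (2 * n + 1 - a%:R + 2 * kq + 2 * kr)
                * (n - a%:R + 2 * kr) * (n - a%:R + 2 * kq)
  else (a%:R + 1 + 2 * kp) * (2 * n + 1 - a%:R + 2 * kp + 2 * kq + 2 * kr)
       * (n - a%:R) * (n - a%:R + 2 * kq + 2 * kr).

Hypothesis phi_lo : seg_phi kp kq kr n a0 = 0.
Hypothesis phi_hi : seg_phi kp kq kr n (a0 + d.+1) = 0.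
Hypothesis phi_neq0 : forall j, (j < d)%N -> phi j.+1 != 0.
Hypothesis tau_neq0 : forall j, (j < d)%N -> n - (a0 + j)%:R + kq + kr != 0.
Hypothesis gap_neq0 : forall j, (j < d)%N -> seg_gap (a0 + j) != 0.

Lemma segP_col (w : 'cV_d.+1) (j : 'I_d.+1) :
  (P *m w) j 0 = pd j * w j 0 + (if insub j.+1 is Some i then w i 0 else 0).
Proof.
have /(congr1 (fun u : 'M_1 => u 0 0)) : unit_row F d j *m (P *m w) = (pd j *: unit_row F d j + unit_row F d j.+1) *m w.
  by rewrite mulmxA unit_rowP.
rewrite mulmxDl -scalemxAl !unit_rowE [X in X = _ -> _]mxE => ->; rewrite mxE; congr (_ + _); first by rewrite !mxE.
case: insubP => [i _ ij|]; first by rewrite -ij unit_rowE mxE.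
by rewrite -leqNgt => h; rewrite unit_row0 // mul0mx mxE.
Qed.

Variable S : 'cV[F]_d.+1 -> Prop.
Hypothesis S0 : S 0.
Hypothesis Slin : forall c v w, S v -> S w -> S (c *: v + w).
Hypothesis SP : forall v, S v -> S (P *m v).
Hypothesis SQ : forall v, S v -> S (Q *m v).

Let SZ c v : S v -> S (c *: v).
Proof. by move=> h; have := Slin c h S0; rewrite addr0. Qed.
Let SD v w : S v -> S w -> S (v + w).
Proof. by move=> h1 h2; have := Slin 1 h1 h2; rewrite scale1r. Qed.
Let SB v w : S v -> S w -> S (v - w).
Proof. by move=> h1 h2; rewrite -scaleN1r; apply: SD => //; apply: SZ. Qed.
Let SR v : S v -> S (R *m v).
Proof.
move=> h; rewrite /segR mulmxBl mulmxDl mul_scalar_mx -!mulmxA.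
by apply: SB (SZ _ h); apply: SD; auto.
Qed.

(** P is upper triangular: if m is the last index in the support of a vector, P - pd m removes
    coordinate m and creates none above it. Repeating this, the last nonzero vector is an
    eigenvector. *)
Lemma seg_eigen_ex x : S x -> x != 0 ->
  exists j w, [/\ (j <= d)%N, S w, w != 0 & P *m w = pd j *: w].
Proof.
have H m : (m <= d.+1)%N -> forall x, S x -> x != 0 -> (forall l : 'I_d.+1, (m <= l)%N -> x l 0 = 0) ->
    exists j w, [/\ (j <= d)%N, S w, w != 0 & P *m w = pd j *: w].
  elim: m => [|m IH] lem y Sy ny hy.
    by case/eqP: ny; apply/colP => s; rewrite mxE hy.
  have [e0|ne] := eqVneq (P *m y - pd m *: y) 0.
    by exists m, y; split=> //; apply/eqP; rewrite -subr_eq0 e0.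
  apply: (IH (ltnW lem) _ _ ne); first by apply: SB; [exact: SP|exact: SZ].
  move=> l ml; have -> : (P *m y - pd m *: y) l 0 = (P *m y) l 0 - pd m * y l 0.
    by rewrite mxE; congr (_ + _); rewrite !mxE.
  rewrite segP_col.
  have -> : (if insub l.+1 is Some i then y i 0 else 0) = 0.
    by case: insubP => // i _ il; rewrite hy // il ltnS.
  move: ml; rewrite leq_eqVlt => /orP[/eqP ->|lt]; first by rewrite addr0 subrr.
  by rewrite hy // !mulr0 addr0 subrr.
move=> Sx nx; apply: (H d.+1 (leqnn _) x Sx nx) => l.
by rewrite leqNgt ltn_ord.
Qed.

Lemma seg_eigen_down j w : (j <= d)%N -> S w -> w != 0 -> P *m w = pd j *: w ->
  exists w', [/\ S w', w' != 0 & P *m w' = pd 0%N *: w'].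
Proof.
elim: j w => [|j IH] w jd Sw nw Pw; first by exists w.
(* This sign is pd j + pd (j + 1), so the shifted eigenvalue [eps - th] is pd j. *)
pose eps : F := (-1) ^+ (a0 + j).
have ee : eps * eps = 1 by rewrite /eps -expr2 sqrr_sign.
have dE : 2 * pd j.+1 - eps = - eps * (2 * (n - (a0 + j)%:R + kq + kr)).
  by rewrite /eps /seg_pd addnS exprS -natr1; field.
have t0 := tau_neq0 jd.
have dn0 : 2 * pd j.+1 - eps != 0.
  by rewrite dE !mulf_neq0 ?oppr_eq0 ?signr_eq0 ?pnatr_eq0.
have PQ : P *m Q + Q *m P = R + (kap_r kp kq kr n)%:M by rewrite /segR subrK.
have := ladder PQ (segQR phi_lo phi_hi) (segPR phi_lo phi_hi) (seg_casimir phi_lo phi_hi) ee dn0 _ nw Pw.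
case.
  rewrite dE.
  have -> : casimir kp kq kr n - pd j.+1 ^+ 2 + eps * pd j.+1 + eps * kap_p kp kq kr n -
    ((kap_r kp kq kr n + eps * kap_q kp kq kr n) / (- eps * (2 * (n - (a0 + j)%:R + kq + kr)))) ^+ 2
    = seg_gap (a0 + j) / (n - (a0 + j)%:R + kq + kr) ^+ 2.
    move: t0; rewrite /eps /seg_pd addnS /seg_gap /kap_r /kap_q /kap_p /casimir /k_top.
    move: (a0 + j)%N => a; rewrite [(-1) ^+ a.+1]exprS -[a.+1%:R]natr1 -[(-1) ^+ a]signr_odd.
    by case: (odd a) => /= t0; field.
  by rewrite mulf_neq0 ?gap_neq0 // invr_eq0 expf_neq0.
move=> nw' Pw'; apply: (IH _ (ltnW jd) _ nw').
  by apply: SB (SZ _ Sw); apply: SD; [exact: SQ|exact/SZ/SR].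
by rewrite Pw'; congr (_ *: _); rewrite /eps /seg_pd addnS exprS -natr1; ring.
Qed.

(** An eigenvector for pd 0 satisfies w_(j+1) = (pd 0 - pd j) w_j, hence w_1 = 0 and all later
    entries vanish. It is a multiple of the first basis vector, from which Q generates the others
    through its nonzero subdiagonal. *)
Lemma segPQ_irreducible x : S x -> x != 0 -> forall v, S v.
Proof.
move=> Sx nx; have [j [w [jd Sw nw Pw]]] := seg_eigen_ex Sx nx.
have {j w jd Sw nw Pw x Sx nx} [w [Sw nw Pw]] := seg_eigen_down jd Sw nw Pw.
have wj (j : 'I_d.+1) : (0 < j)%N -> w j 0 = 0.
  case: j => j; elim: j => // j IH lt _.
  have h := segP_col w (Ordinal (ltnW lt)).
  move: h; rewrite /= insubT Pw mxE => h.
  have -> : w (Ordinal lt) 0 = (pd 0%N - pd j) * w (Ordinal (ltnW lt)) 0 by rewrite mulrBl h addrC addKr.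
  by case: j lt {h} IH => [|j] lt IH; rewrite ?subrr ?mul0r // IH ?mulr0.
have [c we] : exists c, w = c *: delta_mx ord0 0.
  exists (w ord0 0); apply/colP => s; rewrite !mxE andbT.
  case: (unliftP ord0 s) => [i ->|->]; last by rewrite mulr1.
  by rewrite wj // mulr0.
have c0 : c != 0 by apply: contraNneq nw => e; rewrite we e scale0r.
have Sd (j : 'I_d.+1) : S (delta_mx j 0).
  case: j => j; elim: j => [|j IH] lt.
    have := SZ c^-1 Sw; rewrite we scalerA mulVf // scale1r.
    by congr S; congr delta_mx; apply: val_inj.
  have := SZ (phi j.+1)^-1 (SB (SQ (IH (ltnW lt))) (SZ (seg_qd kp kr (a0 + j)) (IH (ltnW lt)))).
  congr S; rewrite -colE; apply/colP => s; rewrite !mxE !andbT -!(inj_eq val_inj) /=.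
  have [->|ne] := eqVneq (s : nat) j; first by rewrite mulr1 subrr mulr0 ltn_eqF.
  rewrite mulr0 subr0; have [->|ne2] := eqVneq (s : nat) j.+1; last by rewrite mulr0.
  by rewrite mulVf // phi_neq0.
move=> v; rewrite (matrix_sum_delta v).
elim/big_ind: _ => // i _; elim/big_ind: _ => // k _.
by rewrite ord1; apply: SZ.
Qed.
End Irreducible.

(** * Chains of left vectors and the modules E_d, O_d *)

Section Chain.
Variables (F : fieldType) (D : nat) (X Y : 'M[F]_D) (kap mu : F).
Variables (alpha beta psi : nat -> F) (chain : nat -> 'rV[F]_D).

Hypothesis chainX : forall i, chain i *m X = beta i *: chain i + chain i.+1.
Hypothesis rel : X *m X *m Y + 2 *: (X *m Y *m X) + Y *m X *m X = (2 * kap) *: X + Y + mu%:M.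
Hypothesis start : chain 0 *m Y = alpha 0 *: chain 0.
Hypothesis base : chain 1 *m Y = alpha 1 *: chain 1 + psi 1 *: chain 0.
Hypothesis psi0 : psi 0 = 0.
Hypothesis alpha_rec : forall i, alpha i.+2 = - alpha i - 2 * alpha i.+1.
Hypothesis psi_rec : forall i, psi i.+2 = 2 * kap - (alpha i + alpha i.+1) * (beta i + beta i.+1)
   - psi i - 2 * psi i.+1 - 2 * alpha i * beta i - 2 * alpha i.+1 * beta i.+1.
Hypothesis diag_rec : forall i, 2 * kap * beta i + alpha i + mu - psi i * (beta i.-1 + beta i)
  - 4 * alpha i * beta i ^+ 2 - 2 * beta i * psi i - 2 * psi i.+1 * beta i - (beta i + beta i.+1) * psi i.+1 = 0.
Hypothesis beta_rec : forall i, (beta i + beta i.+1) ^+ 2 = 1.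

(** Applying the cubic relation [rel] to [chain i] expresses [chain i.+2 *m Y] through rows already
    known. Then [alpha_rec], [psi_rec] and [diag_rec] are the comparison of the coefficients of
    chain i+2, i+1 and i, and [beta_rec] cancels the one of chain i-1. *)
Lemma chainY i : chain i.+1 *m Y = alpha i.+1 *: chain i.+1 + psi i.+1 *: chain i.
Proof.
suff: chain i *m Y = alpha i *: chain i + psi i *: chain i.-1 /\
   chain i.+1 *m Y = alpha i.+1 *: chain i.+1 + psi i.+1 *: chain i by case.
elim: i => [|i [IH1 IH2]]; first by rewrite psi0 scale0r addr0.
split=> //.
have E : (chain i *m X *m X) *m Y = (2 * kap) *: (chain i *m X) + chain i *m Y + mu *: chain i
   - 2 *: (chain i *m X *m Y *m X) - chain i *m Y *m X *m X.
  have relE : X *m X *m Y = (2 * kap) *: X + Y + mu%:M - 2 *: (X *m Y *m X) - Y *m X *m X.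
    rewrite -rel; move: (X *m X *m Y) (X *m Y *m X) (Y *m X *m X) => A B C.
    by apply/matrixP => k l; rewrite !mxE; ring.
  by rewrite -!mulmxA !(mulmxA X) relE !(mulmxBr, mulmxDr) -!scalemxAr mul_mx_scalar !mulmxA.
(* The truncated predecessor at i = 0 is harmless, since [psi 0 = 0]. *)
have B : psi i *: chain i.-1 = (psi i * (beta i.-1 + beta i) ^+ 2) *: chain i.-1.
  by case: (i) => [|i']; rewrite ?psi0 ?mul0r ?scale0r // beta_rec mulr1.
have E2 : chain i.+2 *m Y = (chain i *m X *m X) *m Y - (beta i + beta i.+1) *: (chain i.+1 *m Y)
   - beta i ^+ 2 *: (chain i *m Y).
  rewrite !scalemxAl -!mulmxBl; congr (_ *m _).
  rewrite !chainX mulmxDl -scalemxAl !chainX.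
  by apply/rowP => s; rewrite !mxE; ring.
rewrite E2 E chainX IH1 !mulmxDl -!scalemxAl IH1 IH2 !mulmxDl -!scalemxAl !chainX.
rewrite !mulmxDl -!scalemxAl !chainX.
have := diag_rec i; move: B; rewrite psi_rec alpha_rec => B G.
have -> : psi i = if i is 0 then 0 else psi i by case: (i).
case: i B G {E E2 IH1 IH2} => [|i] B G; apply/rowP => s; move/rowP: B => /(_ s); rewrite !mxE => B.
  apply/eqP; rewrite -subr_eq0 -[X in _ == X](mul0r (chain 0%N 0 s)) -[X in _ == X * _]G psi0.
  by apply/eqP; ring.
apply/eqP; rewrite -subr_eq0 -[X in _ == X](mul0r (chain i.+1 0 s)) -[X in _ == X * _]G -[X in _ == X]addr0.
by move/eqP: B; rewrite -subr_eq0 => /eqP Bz; rewrite -[X in _ == _ + X]Bz /=; apply/eqP; ring.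
Qed.
End Chain.

(* m1 (Y - (s - a0)) (Y + s + a0) is a multiple of m0, and Y + s + a0 is injective. *)
Lemma eigen_base (F : fieldType) (D : nat) (X Y : 'M[F]_D) (kap lam s a0 b0 psi : F) (m0 : 'rV[F]_D) :
    Y *m Y *m X + 2 *: (Y *m X *m Y) + X *m Y *m Y = (2 * kap) *: Y + X + lam%:M ->
    m0 *m Y = a0 *: m0 -> s ^+ 2 = 1 ->
    (forall v : 'rV_D, v *m Y = (- s - a0) *: v -> v = 0) ->
    psi * (2 * a0 + s) = 2 * kap * a0 + lam - b0 * (2 * a0 - s) * (2 * a0 + s) ->
    let m1 := m0 *m X - b0 *: m0 in m1 *m Y = (s - a0) *: m1 + psi *: m0.
Proof.
move=> rel mY ss noev psiE m1; apply/eqP; rewrite -subr_eq0; apply/eqP; apply: noev.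
have /(congr1 (fun A => m0 *m A)) := rel.
rewrite !mulmxDr -!scalemxAr mul_mx_scalar !mulmxA mY -!scalemxAl mY -!scalemxAl => E.
have {}E : m0 *m X *m Y *m Y = (2 * kap * a0 + lam) *: m0 + m0 *m X - a0 ^+ 2 *: (m0 *m X) - (2 * a0) *: (m0 *m X *m Y).
  move: E; move: (m0 *m X) => C; move: (C *m Y) => B; move: (B *m Y) => A E.
  have -> : A = a0 *: (a0 *: C) + 2 *: (a0 *: B) + A - a0 *: (a0 *: C) - 2 *: (a0 *: B).
    by apply/rowP => k; rewrite !mxE; ring.
  by rewrite E; apply/rowP => k; rewrite !mxE; ring.
rewrite /m1 !(mulmxDl, mulNmx, mulmxBl) -!scalemxAl !(mulmxDl, mulmxBl, mulNmx) -!scalemxAl E !(mY, =^~ scalemxAl).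
have {}psiE : lam = psi * (2 * a0 + s) - 2 * kap * a0 + b0 * (2 * a0 - s) * (2 * a0 + s).
  by rewrite psiE; ring.
move: (m0 *m X) => A; move: (A *m Y) => B; apply/rowP => k; rewrite !mxE psiE.
apply/eqP; rewrite -subr_eq0; apply/eqP.
transitivity ((1 - s ^+ 2) * A 0 k); last by rewrite ss subrr mul0r.
by ring.
Qed.

Section SplitSequences.
Variable F : numFieldType.
Variables (d a b c : F).

(* The sequences theta, theta* and phi of E_d and O_d, read backwards from d. *)
Definition rev_theta (s x : F) (i : nat) : F := s * (-1) ^+ i * (2 * x + d - 2 * i%:R) / 2.
Definition rev_phiO (i : nat) : F :=
  if odd i then (d + 1 - i%:R) * (2 * i%:R - d - 1 - 2 * a - 2 * b - 2 * c) / 2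
  else - i%:R * (2 * i%:R - d - 1 - 2 * a - 2 * b + 2 * c) / 2.
Definition rev_phiE (i : nat) : F :=
  if odd i then c ^+ 2 - (2 * a + 2 * b + d + 1 - 2 * i%:R) ^+ 2 / 4
  else (d + 1 - i%:R) * i%:R.

Lemma rev_theta_rec s x i : rev_theta s x i.+2 = - rev_theta s x i - 2 * rev_theta s x i.+1.
Proof. by rewrite /rev_theta !exprS -!natr1; field. Qed.

Lemma rev_theta_sqr s x i : s ^+ 2 = 1 -> (rev_theta s x i + rev_theta s x i.+1) ^+ 2 = 1.
Proof.
move=> ss; rewrite /rev_theta !exprS -!natr1.
have := sqrr_sign F i; move: ((-1) ^+ i) => e ee.
transitivity (s ^+ 2 * e ^+ 2); last by rewrite ss ee mulr1.
by field.
Qed.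

Section O.
Let al := rev_theta 1 b.
Let be := rev_theta 1 a.
(** [kap] and [mu] are the values of {X, Y} - Z and {X, Z} - Y in [O_iso]; the pair in the next
    section is that of [E_iso]. *)
Let kap := 2 * a * b - c * (d + 1).
Let mu := 2 * c * a - b * (d + 1).
Lemma rev_phiO_rec i : rev_phiO i.+2 = 2 * kap - (al i + al i.+1) * (be i + be i.+1)
   - rev_phiO i - 2 * rev_phiO i.+1 - 2 * al i * be i - 2 * al i.+1 * be i.+1.
Proof.
rewrite /rev_phiO /al /be /kap /rev_theta !exprS -[(-1) ^+ i]signr_odd -!natr1 /=.
by case: (odd i) => /=; field.
Qed.
Lemma rev_phiO_diag i : 2 * kap * be i + al i + mu - rev_phiO i * (be i.-1 + be i)
  - 4 * al i * be i ^+ 2 - 2 * be i * rev_phiO i - 2 * rev_phiO i.+1 * be i - (be i + be i.+1) * rev_phiO i.+1 = 0.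
Proof.
(* Removes the predecessor: consecutive thetas add up to a sign, and at i = 0 the factor
   [rev_phiO 0] is 0. *)
have -> : rev_phiO i * (be i.-1 + be i) = rev_phiO i * - (-1) ^+ i.
  case: i => [|i]; first by rewrite /rev_phiO /= oppr0 !mul0r.
  by congr (_ * _); rewrite /be /rev_theta !exprS -!natr1 /=; field.
rewrite /rev_phiO /al /be /kap /mu /rev_theta !exprS -[(-1) ^+ i]signr_odd -!natr1 /=.
by case: (odd i) => /=; field.
Qed.
End O.

Section E.
Let al := rev_theta (-1) b.
Let be := rev_theta (-1) a.
Let kap := c ^+ 2 - a ^+ 2 - b ^+ 2 + (d + 1) ^+ 2 / 4.
Let mu := b ^+ 2 - c ^+ 2 - a ^+ 2 + (d + 1) ^+ 2 / 4.
Lemma rev_phiE_rec i : rev_phiE i.+2 = 2 * kap - (al i + al i.+1) * (be i + be i.+1)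
   - rev_phiE i - 2 * rev_phiE i.+1 - 2 * al i * be i - 2 * al i.+1 * be i.+1.
Proof.
rewrite /rev_phiE /al /be /kap /rev_theta !exprS -[(-1) ^+ i]signr_odd -!natr1 /=.
by case: (odd i) => /=; field.
Qed.
Lemma rev_phiE_diag i : 2 * kap * be i + al i + mu - rev_phiE i * (be i.-1 + be i)
  - 4 * al i * be i ^+ 2 - 2 * be i * rev_phiE i - 2 * rev_phiE i.+1 * be i - (be i + be i.+1) * rev_phiE i.+1 = 0.
Proof.
have -> : rev_phiE i * (be i.-1 + be i) = rev_phiE i * (-1) ^+ i.
  case: i => [|i]; first by rewrite /rev_phiE /= mulr0 !mul0r.
  by congr (_ * _); rewrite /be /rev_theta !exprS -!natr1 /=; field.
rewrite /rev_phiE /al /be /kap /mu /rev_theta !exprS -[(-1) ^+ i]signr_odd -!natr1 /=.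
by case: (odd i) => /=; field.
Qed.
End E.
End SplitSequences.

Section Intertwine.
Variable R : realType.
Local Notation C := R[i].

Lemma row_bidiagX d (theta : nat -> C) (r : 'I_d.+1) : row r (bidiagX d theta)
  = theta r *: unit_row C d r + (if (r : nat) is r'.+1 then unit_row C d r' else 0).
Proof.
apply/rowP => s; rewrite !mxE -!(inj_eq val_inj) /= [in LHS]eq_sym.
case: (val r) => [|r'] /=; rewrite mxE.
  by case: eqP => _; rewrite ?mulr1 ?mulr0 addr0.
rewrite eqSS [r' == _]eq_sym; case: eqP => [->|_]; last by rewrite mulr0 add0r; case: eqP.
by rewrite gtn_eqF // mulr1 addr0.
Qed.

Lemma row_bidiagY d (theta phi : nat -> C) (r : 'I_d.+1) : row r (bidiagY d theta phi)
  = theta r *: unit_row C d r + phi r.+1 *: unit_row C d r.+1.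
Proof.
apply/rowP => s; rewrite !mxE -!(inj_eq val_inj) /= [in LHS]eq_sym.
case: eqP => [->|_]; first by rewrite ltn_eqF // mulr1 mulr0 addr0.
by rewrite mulr0 add0r; case: eqP => [->|_]; rewrite ?mulr1 ?mulr0.
Qed.

Lemma unit_row_stack d m (A : nat -> 'rV[C]_m) (j : nat) :
  unit_row C d j *m (\matrix_(i < d.+1) A i) = if (j <= d)%N then A j else 0.
Proof.
case: leqP => h; last by rewrite unit_row0 // mul0mx.
by rewrite (unit_rowE (Ordinal (h : (j < d.+1)%N))) rowK.
Qed.

(** The chain is stacked from last to first: X takes m_i to m_i and m_(i+1), whereas row r of the
    matrix of X on E_d or O_d involves r and r - 1. *)
Lemma chain_intertwine d (X Y : 'M[C]_d.+1) (m : nat -> 'rV[C]_d.+1)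
    (al be ps theta thetas phi : nat -> C) :
    (forall i, m i *m X = be i *: m i + m i.+1) ->
    (forall i, m i.+1 *m Y = al i.+1 *: m i.+1 + ps i.+1 *: m i) ->
    m 0%N *m Y = al 0%N *: m 0%N -> m d.+1 = 0 ->
    (forall i, (i <= d)%N -> theta i = be (d - i)%N) ->
    (forall i, (i <= d)%N -> thetas i = al (d - i)%N) ->
    (forall i, (i < d)%N -> phi i.+1 = ps (d - i)%N) ->
  let S := \matrix_(i < d.+1) m (d - i)%N in
  S *m X = bidiagX d theta *m S /\ S *m Y = bidiagY d thetas phi *m S.
Proof.
move=> mX mY mY0 me th ths ph S; split; apply/row_matrixP => i; rewrite !row_mul rowK.
  rewrite row_bidiagX mulmxDl -scalemxAl (unit_row_stack _ (fun i => m (d - i)%N)) mX th ?leq_ord //.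
  congr (_ + _); case: (val i) (leq_ord i) => [|i'] h; first by rewrite subn0 mul0mx me.
  by rewrite (unit_row_stack _ (fun i => m (d - i)%N)) ltnW // -subSn ?subSS // ltnW.
rewrite row_bidiagY mulmxDl -!scalemxAl !(unit_row_stack _ (fun i => m (d - i)%N)) leq_ord.
rewrite ths ?leq_ord //; case: ltnP (leq_ord i) => h h2.
  by rewrite ph // -[in LHS](subnSK h) mY subnSK.
have -> : (d - i = 0)%N by apply/eqP; rewrite subn_eq0.
by rewrite mY0 scaler0 addr0.
Qed.
End Intertwine.

(** * Left eigenvalues of triangular matrices *)

Lemma trig_eigen (F : fieldType) n (M : 'M[F]_n) (x : F) :
  is_trig_mx M || is_trig_mx M^T ->
  (exists2 v : 'rV_n, v != 0 & v *m M = x *: v) <-> exists j, M j j = x.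
Proof.
move=> tri; have -> : (exists2 v : 'rV_n, v != 0 & v *m M = x *: v) <->
    (exists2 v : 'rV_n, v != 0 & v *m (M - x%:M) = 0).
  split=> -[v nv h]; exists v => //; first by rewrite mulmxBr h mul_mx_scalar subrr.
  by apply/eqP; rewrite -subr_eq0 -mul_mx_scalar -mulmxBr h.
have dE : \det (M - x%:M) = \prod_i (M i i - x).
  have tr (N : 'M[F]_n) : is_trig_mx N -> \det (N - x%:M) = \prod_i (N i i - x).
    move=> /is_trig_mxP h; rewrite det_trig.
      by apply: eq_bigr => i _; rewrite !mxE eqxx.
    apply/is_trig_mxP => i j ij; rewrite !mxE h // sub0r -(inj_eq val_inj) /= ltn_eqF // oppr0 //.
  case/orP: tri => /tr // h; rewrite -det_tr linearB /= tr_scalar_mx h.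
  by apply: eq_bigr => i _; rewrite mxE.
split=> [h|[j e]].
  have : \det (M - x%:M) == 0 by apply/det0P.
  rewrite dE prodf_seq_eq0 => /hasP[j _ /=].
  by rewrite subr_eq0 => /eqP; exists j.
by apply/det0P; rewrite dE (bigD1 j) //= e subrr mul0r.
Qed.

Section SegEigen.
Variables (F : numFieldType) (d : nat) (pd qd phi : nat -> F).

Lemma rawP_eigen x : (exists2 v : 'rV_d.+1, v != 0 & v *m rawP d pd = x *: v) <->
  exists2 j, (j <= d)%N & pd j = x.
Proof.
rewrite trig_eigen; last first.
  apply/orP; right; apply/is_trig_mxP => i j ij; rewrite !mxE -!(inj_eq val_inj) /=.
  by rewrite gtn_eqF // ltn_eqF // ltnW.
split=> [[j]|[j jd e]]; first by rewrite mxE eqxx => <-; exists j => //; rewrite leq_ord.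
by exists (Ordinal (jd : (j < d.+1)%N)); rewrite mxE eqxx.
Qed.

Lemma rawQ_eigen x : (exists2 v : 'rV_d.+1, v != 0 & v *m rawQ d qd phi = x *: v) <->
  exists2 j, (j <= d)%N & qd j = x.
Proof.
rewrite trig_eigen; last first.
  apply/orP; left; apply/is_trig_mxP => i j ij; rewrite !mxE -!(inj_eq val_inj) /=.
  by rewrite ltn_eqF // ltn_eqF // ltnW.
split=> [[j]|[j jd e]]; first by rewrite mxE eqxx => <-; exists j => //; rewrite leq_ord.
by exists (Ordinal (jd : (j < d.+1)%N)); rewrite mxE eqxx.
Qed.
End SegEigen.

(** * Isomorphisms obtained from irreducibility *)

Section Iso.
Variable R : realType.
Local Notation C := R[i].

(** This form, in which one nonzero vector generates everything, avoids the disjunction of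
    [bimod_irreducible]; excluded middle enters only in [irred3_bimod]. *)
Definition irred3 d (X Y Z : 'M[C]_d) := forall S : 'cV[C]_d -> Prop,
  S 0 -> (forall c v w, S v -> S w -> S (c *: v + w)) ->
  (forall v, S v -> S (X *m v)) -> (forall v, S v -> S (Y *m v)) ->
  (forall v, S v -> S (Z *m v)) ->
  forall x, S x -> x != 0 -> forall v, S v.

(** Schur's argument: the kernel of S is invariant and not everything, so it is 0, and S is square.
    Invariant subspaces of the target then pull back along S. *)
Lemma irred_intertwine d (X Y Z X' Y' Z' S : 'M[C]_d) :
  irred3 X Y Z -> S *m X = X' *m S -> S *m Y = Y' *m S -> S *m Z = Z' *m S ->
  S != 0 -> S \in unitmx /\ irred3 X' Y' Z'.
Proof.
move=> irr SX SY SZ nS.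
have uS : S \in unitmx.
  rewrite unitmxE unitfE -det_tr; apply/negP => /det0P[v nv vS].
  have Sv : S *m v^T = 0 by rewrite -[S]trmxK -trmx_mul vS trmx0.
  have nvT : v^T != 0 by rewrite -trmx0 (inj_eq trmx_inj).
  have H : forall x : 'cV_d, S *m x = 0.
    apply: (irr (fun x => S *m x = 0) _ _ _ _ _ _ Sv nvT); first by rewrite mulmx0.
    - by move=> c u w hu hw; rewrite mulmxDr -scalemxAr hu hw scaler0 addr0.
    - by move=> u hu; rewrite mulmxA SX -mulmxA hu mulmx0.
    - by move=> u hu; rewrite mulmxA SY -mulmxA hu mulmx0.
    by move=> u hu; rewrite mulmxA SZ -mulmxA hu mulmx0.
  case/eqP: nS; apply/matrixP => i j.
  by have := H (delta_mx j 0); rewrite -colE => /colP/(_ i); rewrite !mxE.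
split=> // T T0 Tl TX TY TZ x Tx nx v.
rewrite -(mulKVmx uS v); move: (invmx S *m v) => {}v.
apply: (irr (fun y => T (S *m y)) _ _ _ _ _ (invmx S *m x)); rewrite ?mulKVmx ?mulmx0 //.
- by move=> c u w hu hw; rewrite mulmxDr -scalemxAr; apply: Tl.
- by move=> u hu; rewrite mulmxA SX -mulmxA; apply: TX.
- by move=> u hu; rewrite mulmxA SY -mulmxA; apply: TY.
- by move=> u hu; rewrite mulmxA SZ -mulmxA; apply: TZ.
by apply: contraNneq nx => e; rewrite -(mulKVmx uS x) e mulmx0.
Qed.

Definition bi_iso (W : bimod R) (X Y Z : 'M[C]_(bdim W)) :=
  exists S, [/\ S \in unitmx, S *m X = bX W *m S, S *m Y = bY W *m S & S *m Z = bZ W *m S].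

Lemma irred3_bimod (W : bimod R) : (0 < bdim W)%N -> irred3 (bX W) (bY W) (bZ W) -> bimod_irreducible W.
Proof.
move=> W0 irr; split=> // S S0 Sl SX SY SZ.
case: (boolp.EM (exists2 x, S x & x != 0)) => [[x Sx nx]|no].
  by right; apply: irr Sx nx.
by left => v Sv; apply/eqP; apply: contra_notT no => nv; exists v.
Qed.

(** Eliminating Z leaves a relation in X and Y alone, the form in which the algebra enters the chain
    recursion. *)
Lemma anticomm_cubic (d : nat) (X Y Z : 'M[C]_d) kap mu : X *m Y + Y *m X = Z + kap%:M ->
  X *m Z + Z *m X = Y + mu%:M ->
  X *m X *m Y + 2 *: (X *m Y *m X) + Y *m X *m X = (2 * kap) *: X + Y + mu%:M.
Proof.
move=> h1 h2; have ZE : Z = X *m Y + Y *m X - kap%:M by rewrite h1 addrK.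
have -> : X *m X *m Y + 2 *: (X *m Y *m X) + Y *m X *m X =
   X *m Z + Z *m X + (2 * kap) *: X.
  rewrite ZE mulmxBr mulmxBl mulmxDr mulmxDl mul_mx_scalar mul_scalar_mx !mulmxA.
  by apply/matrixP => i j; rewrite !mxE; ring.
by rewrite h2 addrC addrA.
Qed.

Lemma row_start_chain d (X : 'M[C]_d) (be : nat -> C) (m0 : 'rV[C]_d) :
  exists2 m : nat -> 'rV[C]_d, m 0%N = m0 & forall i, m i *m X = be i *: m i + m i.+1.
Proof.
exists (fix m i := if i is j.+1 then m j *m X - be j *: m j else m0) => // i.
by rewrite addrC subrK.
Qed.

Section FromChain.
Variables (d : nat) (a b c : C) (X Y Z : 'M[C]_d.+1) (m0 : 'rV[C]_d.+1).
Hypothesis irr : irred3 X Y Z.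
Hypothesis m0_neq0 : m0 != 0.

(** Since psi_(d+1) = 0, the row m_(d+1) would be a left eigenvector of Y for alpha_(d+1), a value
    that is not an eigenvalue. So the chain ends with m_d; its rows form an intertwiner, nonzero
    because m_0 is one of them. *)
Lemma bi_iso_of_chain kap (al be ps theta thetas phi : nat -> C) mu :
    X *m Y + Y *m X = Z + kap%:M -> X *m Z + Z *m X = Y + mu%:M ->
    m0 *m Y = al 0%N *: m0 ->
    (let m1 := m0 *m X - be 0%N *: m0 in m1 *m Y = al 1%N *: m1 + ps 1%N *: m0) ->
    ps 0%N = 0 -> ps d.+1 = 0 ->
    (forall i, al i.+2 = - al i - 2 * al i.+1) ->
    (forall i, ps i.+2 = 2 * kap - (al i + al i.+1) * (be i + be i.+1)
      - ps i - 2 * ps i.+1 - 2 * al i * be i - 2 * al i.+1 * be i.+1) ->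
    (forall i, 2 * kap * be i + al i + mu - ps i * (be i.-1 + be i)
      - 4 * al i * be i ^+ 2 - 2 * be i * ps i - 2 * ps i.+1 * be i - (be i + be i.+1) * ps i.+1 = 0) ->
    (forall i, (be i + be i.+1) ^+ 2 = 1) ->
    (forall v : 'rV_d.+1, v *m Y = al d.+1 *: v -> v = 0) ->
    (forall i, (i <= d)%N -> theta i = be (d - i)%N) ->
    (forall i, (i <= d)%N -> thetas i = al (d - i)%N) ->
    (forall i, (i < d)%N -> phi i.+1 = ps (d - i)%N) ->
  let W := BIMod (bidiagX d theta) (bidiagY d thetas phi)
    (anticomm (bidiagX d theta) (bidiagY d thetas phi) - kap%:M) in
  bi_iso (W := W) X Y Z /\ bimod_irreducible W.
Proof.
move=> XY XZ st ba p0 pd alr psr dr ber noev th ths ph W.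
have [m m0E mX] := row_start_chain X be m0.
have m1E : m 1%N = m0 *m X - be 0%N *: m0 by rewrite -m0E mX addrC addKr.
have mY0 : m 0%N *m Y = al 0%N *: m 0%N by rewrite m0E.
have mY := chainY mX (anticomm_cubic XY XZ) mY0 _ p0 alr psr dr ber.
have {}mY i : m i.+1 *m Y = al i.+1 *: m i.+1 + ps i.+1 *: m i.
  by apply: mY; rewrite m1E m0E.
have mz : m d.+1 = 0 by apply: noev; rewrite mY pd scale0r addr0.
have /= [SX SY] := chain_intertwine mX mY mY0 mz th ths ph.
set S := \matrix_(i < _) _ in SX SY.
have SZ : S *m Z = bZ W *m S.
  have -> : Z = X *m Y + Y *m X - kap%:M by rewrite XY addrK.
  rewrite /= /anticomm mulmxBr mulmxBl mulmxDr mulmxDl !mulmxA SX SY -!mulmxA SX SY.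
  by rewrite mul_mx_scalar mul_scalar_mx.
have nS : S != 0.
  apply: contraNneq m0_neq0 => S0; have := congr1 (row ord_max) S0.
  by rewrite rowK subnn m0E row0 => ->.
have [uS irr'] := irred_intertwine irr SX SY SZ nS.
by split; [exists S|apply: irred3_bimod].
Qed.

Lemma O_iso : ~~ odd d ->
    X *m Y + Y *m X = Z + (2 * a * b - c * (d%:R + 1))%:M ->
    X *m Z + Z *m X = Y + (2 * c * a - b * (d%:R + 1))%:M ->
    m0 *m Y = rev_theta d%:R 1 b 0 *: m0 ->
    (let m1 := m0 *m X - rev_theta d%:R 1 a 0 *: m0 in
       m1 *m Y = rev_theta d%:R 1 b 1 *: m1 + rev_phiO d%:R a b c 1 *: m0) ->
    (forall v : 'rV_d.+1, v *m Y = rev_theta d%:R 1 b d.+1 *: v -> v = 0) ->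
  bi_iso (W := Omod d a b c) X Y Z /\ bimod_irreducible (Omod d a b c).
Proof.
move=> dev XY XZ st ba noev.
apply: (bi_iso_of_chain XY XZ st ba).
- by rewrite /rev_phiO /= oppr0 !mul0r.
- by rewrite /rev_phiO /= dev -natr1 subrr !mul0r.
- exact: rev_theta_rec.
- exact: rev_phiO_rec.
- exact: rev_phiO_diag.
- by move=> i; rewrite rev_theta_sqr // expr1n.
- exact: noev.
- move=> i id; rewrite /theta_ /rev_theta natrB // -[in RHS]signr_odd oddB // (negbTE dev) /= signr_odd.
  by congr (_ / _); ring.
- move=> i id; rewrite /theta_ /rev_theta natrB // -[in RHS]signr_odd oddB // (negbTE dev) /= signr_odd.
  by congr (_ / _); ring.
move=> i id; rewrite /rev_phiO oddB ?(ltnW id) // (negbTE dev) /= natrB ?(ltnW id) // -natr1.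
by rewrite if_neg; case: odd; field.
Qed.

Lemma E_iso : odd d ->
    X *m Y + Y *m X = Z + (c ^+ 2 - a ^+ 2 - b ^+ 2 + (d%:R + 1) ^+ 2 / 4)%:M ->
    X *m Z + Z *m X = Y + (b ^+ 2 - c ^+ 2 - a ^+ 2 + (d%:R + 1) ^+ 2 / 4)%:M ->
    m0 *m Y = rev_theta d%:R (-1) b 0 *: m0 ->
    (let m1 := m0 *m X - rev_theta d%:R (-1) a 0 *: m0 in
       m1 *m Y = rev_theta d%:R (-1) b 1 *: m1 + rev_phiE d%:R a b c 1 *: m0) ->
    (forall v : 'rV_d.+1, v *m Y = rev_theta d%:R (-1) b d.+1 *: v -> v = 0) ->
  bi_iso (W := Emod d a b c) X Y Z /\ bimod_irreducible (Emod d a b c).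
Proof.
move=> dod XY XZ st ba noev.
apply: (bi_iso_of_chain XY XZ st ba).
- by rewrite /rev_phiE /= mulr0.
- by rewrite /rev_phiE /= dod /= -natr1 subrr !mul0r.
- exact: rev_theta_rec.
- exact: rev_phiE_rec.
- exact: rev_phiE_diag.
- by move=> i; rewrite rev_theta_sqr // sqrrN expr1n.
- exact: noev.
- move=> i id; rewrite /theta_ /rev_theta natrB // -[in RHS]signr_odd oddB // dod /= signrN signr_odd.
  by congr (_ / _); ring.
- move=> i id; rewrite /theta_ /rev_theta natrB // -[in RHS]signr_odd oddB // dod /= signrN signr_odd.
  by congr (_ / _); ring.
move=> i id; rewrite /rev_phiE oddB ?(ltnW id) // dod /= natrB ?(ltnW id) // -natr1.
by rewrite if_neg; case: odd => /=; field.
Qed.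
End FromChain.
End Iso.

(** * The segment modules as A, B, C and W_0 *)

Section Instances.
Variable R : realType.
Local Notation C := R[i].

Definition kval (t : nat) : C := - (t%:R / 2).

(** Reduces nonvanishing in the complex numbers to natural numbers, where [lia] applies; c clears
    denominators. *)
Lemma natr_sub_neq0 (x : C) (a b : nat) c : x * c = a%:R - b%:R -> a <> b -> x != 0.
Proof.
move=> e ab; apply: contra_not_neq ab => x0.
by move/eqP: e; rewrite x0 mul0r eq_sym subr_eq0 eqr_nat => /eqP.
Qed.

Variables (tp tq tr n : nat).
Hypotheses (op : odd tp) (oq : odd tq) (or : odd tr) (ev : ~~ odd n) (le : (tp + tq + tr <= n)%N).
Local Notation kp := (kval tp).
Local Notation kq := (kval tq).
Local Notation kr := (kval tr).
Local Notation K1 := (k_top kp kq kr n%:R).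

(** With a = a0 + j, the condition a + 1 <> tp avoids the zero of [a + 1]_p, and a + tq + tr < n,
    together with tp <= n, makes the other factors of [seg_phi] and [seg_gap] positive. *)
Lemma seg_irreducible a0 d : seg_phi kp kq kr n%:R a0 = 0 -> seg_phi kp kq kr n%:R (a0 + d.+1) = 0 ->
  (forall j, (j < d)%N -> (a0 + j).+1 <> tp /\ (a0 + j + tq + tr < n)%N) ->
  irred3 (segP kq kr n%:R d a0) (segQ kp kq kr n%:R d a0) (segR kp kq kr n%:R d a0).
Proof.
move=> lo hi rng S S0 Sl SP SQ SR x; apply: (segPQ_irreducible lo hi) => //.
- move=> j /rng[]; rewrite addnS /seg_phi; move: (a0 + j)%N => a na an.
  case: ifP => oa; rewrite mulf_neq0 //.
  + by apply: (@natr_sub_neq0 _ a.+1 tp 1) => //; rewrite /kval; field.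
  + apply: (@natr_sub_neq0 _ n (a + tq + tr)%N 1); last by lia.
    by rewrite /kval !natrD -natr1; field.
  + by rewrite pnatr_eq0.
  + apply: (@natr_sub_neq0 _ n (a + tr)%N 1); last by lia.
    by rewrite /kval !natrD -natr1; field.
- move=> j /rng[]; move: (a0 + j)%N => a na an.
  apply: (@natr_sub_neq0 _ (2 * n)%N (2 * a + tq + tr)%N 2); last by lia.
  by rewrite /kval !natrD; field.
move=> j /rng[]; move: (a0 + j)%N => a na an; rewrite /seg_gap.
case: ifP => oa; rewrite !mulf_neq0 //.
- by rewrite natr1 pnatr_eq0.
- apply: (@natr_sub_neq0 _ (2 * n + 1)%N (a + tq + tr)%N 1); last by lia.
  by rewrite /kval !natrD; field.
- apply: (@natr_sub_neq0 _ n (a + tr)%N 1); last by lia.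
  by rewrite /kval !natrD; field.
- apply: (@natr_sub_neq0 _ n (a + tq)%N 1); last by lia.
  by rewrite /kval !natrD; field.
- by apply: (@natr_sub_neq0 _ a.+1 tp 1) => //; rewrite /kval -natr1; field.
- apply: (@natr_sub_neq0 _ (2 * n + 1)%N (a + tp + tq + tr)%N 1); last by lia.
  by rewrite /kval !natrD; field.
- by apply: (@natr_sub_neq0 _ n a 1); [rewrite mulr1|lia].
apply: (@natr_sub_neq0 _ n (a + tq + tr)%N 1); last by lia.
by rewrite /kval !natrD; field.
Qed.

(** The zeros 0, tp and n - tq - tr + 1 of [seg_phi] delimit the two segments of exponents of
    x_p. *)
Lemma seg_phi0 : seg_phi kp kq kr n%:R 0 = 0.
Proof. by rewrite /seg_phi /= mul0r. Qed.
Lemma seg_phi_tp : seg_phi kp kq kr n%:R tp = 0.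
Proof. by rewrite /seg_phi op /kval; field. Qed.
Lemma seg_phi_pred : seg_phi kp kq kr n%:R (0 + tp.-1.+1) = 0.
Proof. by rewrite add0n prednK ?odd_gt0 // seg_phi_tp. Qed.
Lemma seg_phi_end : seg_phi kp kq kr n%:R (tp + (n - (tp + tq + tr)).+1) = 0.
Proof.
have -> : (tp + (n - (tp + tq + tr)).+1 = (n - (tq + tr)).+1)%N by lia.
have o : odd (n - (tq + tr)).+1 by lia.
rewrite /seg_phi o -natr1 natrB; last by lia.
by rewrite natrD /kval; field.
Qed.

Lemma quotient_seg_irreducible : irred3 (segP kq kr n%:R tp.-1 0) (segQ kp kq kr n%:R tp.-1 0) (segR kp kq kr n%:R tp.-1 0).
Proof. by apply: (seg_irreducible seg_phi0 seg_phi_pred) => j h; rewrite add0n; split; lia. Qed.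

Lemma natr_pred_tp : tp.-1%:R = tp%:R - 1 :> C.
Proof. by rewrite -[in RHS](prednK (odd_gt0 op)) -natr1 addrK. Qed.

Lemma rawQ_not_eigen (d : nat) (qd phi : nat -> C) x : (forall j, (j <= d)%N -> qd j != x) ->
  forall v : 'rV_d.+1, v *m rawQ d qd phi = x *: v -> v = 0.
Proof.
move=> h v vx; apply/eqP/negPn/negP => nv.
have [j /h/eqP h1 h2] : exists2 j, (j <= d)%N & qd j = x by apply/rawQ_eigen; exists v; eassumption.
by case: h1.
Qed.

Lemma rawP_not_eigen (d : nat) (pd : nat -> C) x : (forall j, (j <= d)%N -> pd j != x) ->
  forall v : 'rV_d.+1, v *m rawP d pd = x *: v -> v = 0.
Proof.
move=> h v vx; apply/eqP/negPn/negP => nv.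
have [j /h/eqP h1 h2] : exists2 j, (j <= d)%N & pd j = x by apply/rawP_eigen; exists v; eassumption.
by case: h1.
Qed.

Lemma unit_row_neq0 d : unit_row C d 0 != 0.
Proof. by apply/eqP => /rowP/(_ ord0)/eqP; rewrite !mxE /= oner_eq0. Qed.

Lemma even_pred_tp : ~~ odd tp.-1. Proof. by move: op; case: (tp). Qed.

(** The excluded value is [seg_qd] at tp, the diagonal entry that would follow the segment. *)
Lemma quotient_segQ_not_eigen (v : 'rV_tp.-1.+1) :
  v *m segQ kp kq kr n%:R tp.-1 0 = rev_theta tp.-1%:R 1 kr tp.-1.+1 *: v -> v = 0.
Proof.
have -> : rev_theta tp.-1%:R 1 kr tp.-1.+1 = rev_theta tp.-1%:R 1 kr tp by rewrite (prednK (odd_gt0 op)).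
apply: rawQ_not_eigen => j jd; rewrite -subr_eq0 add0n /seg_qd /rev_theta -[_ ^+ tp]signr_odd -signr_odd op natr_pred_tp.
case: (boolP (odd j)) => oj /=.
  apply: (@natr_sub_neq0 _ j tp 1); last by lia.
  by rewrite /kval; field.
apply: (@natr_sub_neq0 _ 0 (j + tr + 1)%N 1); last by lia.
by rewrite !natrD /kval; field.
Qed.

(** X and Y are P and Q. The first unit row is a left eigenvector of Q and P leads from it to the
    second, so the base of the chain is read off the matrices. *)
Lemma A_iso : let W := Omod tp.-1 K1 kr kq in
  bi_iso (W := W) (segP kq kr n%:R tp.-1 0) (segQ kp kq kr n%:R tp.-1 0) (segR kp kq kr n%:R tp.-1 0)
  /\ bimod_irreducible W.
Proof.
apply: (O_iso quotient_seg_irreducible (unit_row_neq0 _) even_pred_tp).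
- by rewrite segPQ; congr (_ + _%:M); rewrite natr_pred_tp /kap_r /kval; field.
- by rewrite (segPR seg_phi0 seg_phi_pred); congr (_ + _%:M); rewrite natr_pred_tp /kap_q /kval; field.
- by rewrite segQ_row0; congr (_ *: _); rewrite /seg_qd /rev_theta natr_pred_tp /kval; field.
- have -> : unit_row C tp.-1 0 *m segP kq kr n%:R tp.-1 0 - rev_theta tp.-1%:R 1 K1 0 *: unit_row C tp.-1 0
     = unit_row C tp.-1 1.
    rewrite segP_row addrAC -scalerBl -[RHS]add0r; congr (_ + _).
    have -> : seg_pd kq kr n%:R (0 + 0) - rev_theta tp.-1%:R 1 K1 0 = 0; last by rewrite scale0r.
    by rewrite /seg_pd /rev_theta natr_pred_tp /k_top /kval; field.
  rewrite /= (segQ_row seg_phi_pred) !add0n; congr (_ *: _ + _ *: _).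
    by rewrite /seg_qd /rev_theta natr_pred_tp /kval; field.
  by rewrite /seg_phi /rev_phiO natr_pred_tp /k_top /kval /=; field.
exact: quotient_segQ_not_eigen.
Qed.

(** X is R, whose entry to the right of the first diagonal entry is 1, so the chain again begins
    with the first two unit rows. *)
Lemma C_iso : let W := Omod tp.-1 kq kr K1 in
  bi_iso (W := W) (segR kp kq kr n%:R tp.-1 0) (segQ kp kq kr n%:R tp.-1 0) (segP kq kr n%:R tp.-1 0)
  /\ bimod_irreducible W.
Proof.
have irr : irred3 (segR kp kq kr n%:R tp.-1 0) (segQ kp kq kr n%:R tp.-1 0) (segP kq kr n%:R tp.-1 0).
  by move=> S S0 Sl hR hQ hP; apply: quotient_seg_irreducible.
apply: (O_iso irr (unit_row_neq0 _) even_pred_tp).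
- by rewrite addrC (segQR seg_phi0 seg_phi_pred); congr (_ + _%:M); rewrite natr_pred_tp /kap_p /kval; field.
- by rewrite addrC (segPR seg_phi0 seg_phi_pred); congr (_ + _%:M); rewrite natr_pred_tp /kap_q /kval; field.
- by rewrite segQ_row0; congr (_ *: _); rewrite /seg_qd /rev_theta natr_pred_tp /kval; field.
- have -> : unit_row C tp.-1 0 *m segR kp kq kr n%:R tp.-1 0 - rev_theta tp.-1%:R 1 kq 0 *: unit_row C tp.-1 0
     = unit_row C tp.-1 1.
    rewrite (segR_row0 seg_phi0 seg_phi_pred) addrAC -scalerBl -[RHS]add0r expr0 scale1r; congr (_ + _).
    have -> : 1 * (kq - kp) - 2^-1 - rev_theta tp.-1%:R 1 kq 0 = 0; last by rewrite scale0r.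
    by rewrite /rev_theta natr_pred_tp /kval; field.
  rewrite /= (segQ_row seg_phi_pred) !add0n; congr (_ *: _ + _ *: _).
    by rewrite /seg_qd /rev_theta natr_pred_tp /kval; field.
  by rewrite /seg_phi /rev_phiO natr_pred_tp /k_top /kval /=; field.
exact: quotient_segQ_not_eigen.
Qed.

(** Y is P, and the left eigenvector for its first diagonal entry is in general no unit row:
    triangularity supplies it, and [eigen_base] replaces the computation of the second row. *)
Lemma B_iso : let W := Omod tp.-1 kr K1 kq in
  bi_iso (W := W) (segQ kp kq kr n%:R tp.-1 0) (segP kq kr n%:R tp.-1 0) (segR kp kq kr n%:R tp.-1 0)
  /\ bimod_irreducible W.
Proof.
have irr : irred3 (segQ kp kq kr n%:R tp.-1 0) (segP kq kr n%:R tp.-1 0) (segR kp kq kr n%:R tp.-1 0).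
  by move=> S S0 Sl hQ hP hR; apply: quotient_seg_irreducible.
have [v nv vP] : exists2 v : 'rV_tp.-1.+1, v != 0 & v *m segP kq kr n%:R tp.-1 0 = rev_theta tp.-1%:R 1 K1 0 *: v.
  apply/rawP_eigen; exists 0%N => //.
  by rewrite /seg_pd /rev_theta natr_pred_tp /k_top /kval; field.
apply: (O_iso irr nv even_pred_tp).
- by rewrite addrC segPQ; congr (_ + _%:M); rewrite natr_pred_tp /kap_r /kval; field.
- by rewrite (segQR seg_phi0 seg_phi_pred); congr (_ + _%:M); rewrite natr_pred_tp /kap_p /kval; field.
- exact: vP.
- have rel := anticomm_cubic (segPQ kp kq kr n%:R tp.-1 0) (segPR seg_phi0 seg_phi_pred).
  have -> : rev_theta tp.-1%:R 1 K1 1 = 1 - rev_theta tp.-1%:R 1 K1 0 by rewrite /rev_theta; field.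
  apply: (eigen_base rel vP); first by rewrite expr1n.
    apply: rawP_not_eigen => j jd; rewrite -subr_eq0 add0n /seg_pd /rev_theta -signr_odd natr_pred_tp.
    case: (boolP (odd j)) => oj /=.
      apply: (@natr_sub_neq0 _ (j + 1)%N 0 1); last by lia.
      by rewrite !natrD /k_top /kval; field.
    apply: (@natr_sub_neq0 _ (2 * n + 2)%N (j + tq + tr)%N 1); last by lia.
    by rewrite !natrD /k_top /kval; field.
  by rewrite /rev_phiO /rev_theta /kap_q /kap_r natr_pred_tp /k_top /kval /=; field.
have -> : rev_theta tp.-1%:R 1 K1 tp.-1.+1 = rev_theta tp.-1%:R 1 K1 tp by rewrite (prednK (odd_gt0 op)).
apply: rawP_not_eigen => j jd; rewrite -subr_eq0 add0n /seg_pd /rev_theta -[_ ^+ tp]signr_odd -signr_odd op natr_pred_tp.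
case: (boolP (odd j)) => oj /=.
  apply: (@natr_sub_neq0 _ j tp 1); last by lia.
  by rewrite /k_top /kval; field.
apply: (@natr_sub_neq0 _ (2 * n + 1)%N (j + tp + tq + tr)%N 1); last by lia.
by rewrite !natrD /k_top /kval; field.
Qed.

(** Y is Q, but the required theta*_d is its last diagonal entry, at exponent n - tq - tr, and not
    its first. Hence [eigen_base] is needed here too, with the sign -1 because d is odd. *)
Lemma W0_iso : let N := (n%:R + 1) / 2 : C in
  let d := (n - (tp + tq + tr))%N in
  let W := Emod d (kp + N) (kq + N) (kr + N) in
  bi_iso (W := W) (segP kq kr n%:R d tp) (segQ kp kq kr n%:R d tp) (segR kp kq kr n%:R d tp)
  /\ bimod_irreducible W.
Proof.
move=> N d.
have dR : d%:R = n%:R - tp%:R - tq%:R - tr%:R :> C by rewrite /d natrB // !natrD; ring.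
have dod : odd d by rewrite /d; lia.
have irr : irred3 (segP kq kr n%:R d tp) (segQ kp kq kr n%:R d tp) (segR kp kq kr n%:R d tp).
  by apply: (seg_irreducible seg_phi_tp seg_phi_end) => j h; split; lia.
have [v nv vQ] : exists2 v : 'rV_d.+1, v != 0 & v *m segQ kp kq kr n%:R d tp = rev_theta d%:R (-1) (kq + N) 0 *: v.
  apply/rawQ_eigen; exists d => //.
  have e : ~~ odd (tp + d) by rewrite /d; lia.
  by rewrite /seg_qd /rev_theta natrD -signr_odd (negbTE e) dR /N /kval; field.
apply: (E_iso irr nv dod).
- by rewrite segPQ; congr (_ + _%:M); rewrite dR /kap_r /N /k_top /kval; field.
- by rewrite (segPR seg_phi_tp seg_phi_end); congr (_ + _%:M); rewrite dR /kap_q /N /k_top /kval; field.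
- exact: vQ.
- have QP : segQ kp kq kr n%:R d tp *m segP kq kr n%:R d tp + segP kq kr n%:R d tp *m segQ kp kq kr n%:R d tp
     = segR kp kq kr n%:R d tp + (kap_r kp kq kr n%:R)%:M by rewrite addrC segPQ.
  have rel := anticomm_cubic QP (segQR seg_phi_tp seg_phi_end).
  have -> : rev_theta d%:R (-1) (kq + N) 1 = -1 - rev_theta d%:R (-1) (kq + N) 0 by rewrite /rev_theta; field.
  apply: (eigen_base rel vQ); first by rewrite sqrrN expr1n.
    apply: rawQ_not_eigen => j jd; rewrite -subr_eq0 /seg_qd /rev_theta -signr_odd dR /N.
    case: (boolP (odd (tp + j))) => oj /=.
      apply: (@natr_sub_neq0 _ (tp + j + tq + tr)%N (n + 1)%N 1); last by lia.
      by rewrite !natrD /kval; field.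
    apply: (@natr_sub_neq0 _ tq (j + n + 2)%N 1); last by lia.
    by rewrite !natrD /kval; field.
  by rewrite /rev_phiE /rev_theta /kap_p /kap_r dR /N /k_top /kval /=; field.
apply: rawQ_not_eigen => j jd; rewrite -subr_eq0 /seg_qd /rev_theta -signr_odd -[_ ^+ d.+1]signr_odd /= dod dR /N.
case: (boolP (odd (tp + j))) => oj /=.
  apply: (@natr_sub_neq0 _ (tp + j + tr)%N 0 1); last by lia.
  by rewrite !natrD -[d.+1%:R]natr1 dR /kval; field.
apply: (@natr_sub_neq0 _ 0 (j + 1)%N 1); last by lia.
by rewrite !natrD -[d.+1%:R]natr1 dR /kval; field.
Qed.
End Instances.

(** * Coefficients of solutions of the Dirac equation *)

Section Coefficients.
Variable R : realType.
Local Notation C := R[i].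
Local Notation vec := 'cV[C]_2.
Local Notation kval := (kval R).

Definition dunkl_num (k : C) (j : nat) : C := j%:R + k * (1 - (-1) ^+ j).

Lemma dunkl_numE t j : dunkl_num (kval t) j = if odd j then j%:R - t%:R else j%:R.
Proof. by rewrite /dunkl_num -signr_odd /kval; case: odd => /=; field. Qed.

Lemma dunkl_num_t t : odd t -> dunkl_num (kval t) t = 0.
Proof. by move=> o; rewrite dunkl_numE o subrr. Qed.

Lemma dunkl_num_neq0 t j : (0 < j)%N -> j != t -> dunkl_num (kval t) j != 0.
Proof.
move=> j0 jt; rewrite dunkl_numE; case: odd; last by rewrite pnatr_eq0 -lt0n.
by rewrite subr_eq0 eqr_nat.
Qed.

Section Solutions.
Variables (tp tq tr n : nat) (sp sq sr : 'M[C]_2).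
Hypotheses (op : odd tp) (oq : odd tq) (or : odd tr).
Hypotheses (spp : sp *m sp = 1%:M) (sqq : sq *m sq = 1%:M) (srr : sr *m sr = 1%:M).

(** The second clause is the coefficient of x_p^a x_q^b x_r^c in D u, the first clause homogeneity
    of degree n. *)
Definition dirac_sol (W : nat -> nat -> nat -> vec) :=
  (forall a b c, (a + b + c)%N <> n -> W a b c = 0) /\
  (forall a b c, dunkl_num (kval tp) a.+1 *: (sp *m W a.+1 b c)
    + dunkl_num (kval tq) b.+1 *: (sq *m W a b.+1 c)
    + dunkl_num (kval tr) c.+1 *: (sr *m W a b c.+1) = 0).

Variable W : nat -> nat -> nat -> vec.
Hypothesis solW : dirac_sol W.

Lemma dirac_step_r a b c : (c.+1 != tr)%N ->
  dunkl_num (kval tp) a.+1 *: W a.+1 b c = 0 -> dunkl_num (kval tq) b.+1 *: W a b.+1 c = 0 -> W a b c.+1 = 0.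
Proof.
move=> nc hp hq; have := solW.2 a b c.
rewrite !scalemxAr hp hq !mulmx0 !add0r -scalemxAr => /eqP.
rewrite scaler_eq0 (negbTE (dunkl_num_neq0 _ nc)) //= => /eqP h.
by rewrite -(mul1mx (W a b c.+1)) -srr -mulmxA h mulmx0.
Qed.

Lemma dirac_step_q a b c : (b.+1 != tq)%N ->
  dunkl_num (kval tp) a.+1 *: W a.+1 b c = 0 -> dunkl_num (kval tr) c.+1 *: W a b c.+1 = 0 -> W a b.+1 c = 0.
Proof.
move=> nc hp hr; have := solW.2 a b c.
rewrite !scalemxAr hp hr !mulmx0 add0r addr0 -scalemxAr => /eqP.
rewrite scaler_eq0 (negbTE (dunkl_num_neq0 _ nc)) //= => /eqP h.
by rewrite -(mul1mx (W a b.+1 c)) -sqq -mulmxA h mulmx0.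
Qed.

(* Downward induction on a + c: at the corner a = tp - 1, c = tr - 1 two of the
   three Dunkl numbers vanish, and b is larger than tq throughout. *)
Lemma support_pr a b c : (tp + tq + tr <= n)%N -> (a < tp)%N -> (c < tr)%N -> W a b c = 0.
Proof.
move=> le; move: {2}(tp + tr - (a + c))%N (leqnn (tp + tr - (a + c))) => m.
elim: m a b c => [|m IH] a b c hm ha hc; first by lia.
have [e|ne] := eqVneq (a + b + c)%N n; last by apply: solW.1; apply/eqP.
case: b e => [|b] e; first by lia.
apply: dirac_step_q; first by lia.
  have [->|na] := eqVneq a.+1 tp; first by rewrite dunkl_num_t ?scale0r.
  by rewrite IH ?scaler0 //; lia.
have [->|na] := eqVneq c.+1 tr; first by rewrite dunkl_num_t ?scale0r.
by rewrite IH ?scaler0 //; lia.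
Qed.

(** Below c = tr this is [support_pr]. Above, the recurrence carries zeros upwards in c, the region
    a < tp being closed under it because [tp]_p = 0. At c = tr it says nothing, as [tr]_r = 0, and
    the hypothesis fills the gap. *)
Lemma slice_kernel_p : (tp + tq + tr <= n)%N ->
  (forall a b, (a < tp)%N -> W a b tr = 0) -> forall a b c, (a < tp)%N -> W a b c = 0.
Proof.
move=> le h a b c; elim: c a b => [|c IH] a b ha.
  by apply: support_pr => //; apply: odd_gt0.
have [->|nc] := eqVneq c.+1 tr; first exact: h.
apply: dirac_step_r => //; last by rewrite IH ?scaler0.
have [->|na] := eqVneq a.+1 tp; first by rewrite dunkl_num_t ?scale0r.
by rewrite IH ?scaler0 //; lia.
Qed.

Lemma slice_kernel0 : (forall a b c, (c < tr)%N -> W a b c = 0) ->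
  (forall a b, W a b tr = 0) -> forall a b c, W a b c = 0.
Proof.
move=> lo h a b c; elim: c a b => [|c IH] a b; first by rewrite lo ?odd_gt0.
have [->|nc] := eqVneq c.+1 tr; first exact: h.
by apply: dirac_step_r; rewrite // IH scaler0.
Qed.

Variable g : nat -> vec.

Fixpoint slice_ext (l a b : nat) : vec :=
  if l is l'.+1 then
    - (dunkl_num (kval tr) (tr + l)%N)^-1 *: (sr *m (dunkl_num (kval tp) a.+1 *: (sp *m slice_ext l' a.+1 b)
         + dunkl_num (kval tq) b.+1 *: (sq *m slice_ext l' a b.+1)))
  else if (a + b + tr == n)%N then g a else 0.

Definition slice_sol a b c : vec := if (c < tr)%N then 0 else slice_ext (c - tr) a b.

Lemma slice_sol_lt a b c : (c < tr)%N -> slice_sol a b c = 0.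
Proof. by rewrite /slice_sol => ->. Qed.

Lemma slice_sol_slice a b : (a + b + tr)%N = n -> slice_sol a b tr = g a.
Proof. by rewrite /slice_sol ltnn subnn /= => ->; rewrite eqxx. Qed.

(** The values g are free: the equation at c + 1 = tr, which would tie the slice to those below, has
    coefficient [tr]_r = 0. Above it [c + 1]_r is invertible, and the equation is the definition of
    [slice_ext]. *)
Lemma slice_solP : dirac_sol slice_sol.
Proof.
split=> a b c.
  rewrite /slice_sol; case: ltnP => // hc.
  have [l e] : exists l, (c - tr)%N = l by eexists.
  rewrite e; elim: l a b c hc e => [|l IH] a b c hc e ne /=.
    by case: (a + b + tr =P n)%N => // e2; case: ne; lia.
  by rewrite (IH a.+1 b c.-1) ?(IH a b.+1 c.-1) ?mulmx0 ?scaler0 ?addr0 ?mulmx0 ?scaler0 //; lia.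
rewrite /slice_sol; case: (ltngtP c.+1 tr) => hc.
- by rewrite /= !mulmx0 !scaler0 !addr0.
- have hc' : (tr <= c)%N by rewrite -ltnS.
  rewrite /= subSn //= addnS subnKC //.
  rewrite -[in X in _ + X]scalemxAr scalerA mulrN divff; last by apply: dunkl_num_neq0 => //; lia.
  by rewrite scaleN1r mulmxA srr mul1mx subrr.
by rewrite /= !mulmx0 !scaler0 !add0r hc dunkl_num_t // scale0r.
Qed.
End Solutions.

Lemma dirac_sol_swap tp tq tr n sp sq sr W : dirac_sol tp tq tr n sp sq sr W ->
  dirac_sol tq tp tr n sq sp sr (fun b a c => W a b c).
Proof.
case=> h1 h2; split=> a b c; last by have := h2 b a c; rewrite [X in X + _ = _]addrC.
by move=> ne; rewrite h1 //; lia.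
Qed.

Lemma dirac_sol_rot tp tq tr n sp sq sr W : dirac_sol tp tq tr n sp sq sr W ->
  dirac_sol tq tr tp n sq sr sp (fun b c a => W a b c).
Proof.
case=> h1 h2; split=> a b c; last by rewrite -[RHS](h2 c a b) -[RHS]addrA [RHS]addrC.
by move=> ne; rewrite h1 //; lia.
Qed.

(* Coefficient of i s (x_c T_b - x_b T_c) + 1/2 composed with R_b R_c, plus
   k_b R_c + k_c R_b; the other exponent is fixed. *)
Definition rot_coef (i : C) (s : 'M[C]_2) (kb kd : C) (W : nat -> nat -> vec) b c : vec :=
  (-1) ^+ (b + c) *: (i *: (s *m ((if c is c'.+1 then dunkl_num kb b.+1 *: W b.+1 c' else 0)
        - (if b is b'.+1 then dunkl_num kd c.+1 *: W b' c.+1 else 0))) + 2^-1 *: W b c)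
   + (kb * (-1) ^+ c + kd * (-1) ^+ b) *: W b c.

(** Exchanging the two variables of a rotation reverses its sign; this is how odd permutations are
    reduced to the given operators, with -i in place of i. *)
Lemma rot_coef_swap i s kb kd W b c :
  rot_coef i s kb kd W b c = rot_coef (- i) s kd kb (fun c b => W b c) c b.
Proof.
rewrite /rot_coef [(c + b)%N]addnC [kd * _ + _]addrC scaleNr -scalerN -mulmxN opprB //.
Qed.

(** * The three operators on the slice where x_r has exponent t_r *)

Section Slice.
Variables (tp tq tr n : nat) (sp sq sr : 'M[C]_2) (io : C).
Hypotheses (op : odd tp) (oq : odd tq) (or : odd tr) (ev : ~~ odd n).
Hypotheses (spp : sp *m sp = 1%:M) (sqq : sq *m sq = 1%:M) (srr : sr *m sr = 1%:M).
Hypotheses (ii : io * io = -1).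
Hypotheses (spq : sp *m sq = io *: sr) (sqr : sq *m sr = io *: sp) (srp : sr *m sp = io *: sq).
Local Notation kp := (kval tp).
Local Notation kq := (kval tq).
Local Notation kr := (kval tr).

(** (x y)(y x) = 1, so y x is the inverse of io z. It gives the Pauli relations for odd
    permutations, which is why [io] may be either square root of -1. *)
Lemma pauli_swap (x y z : 'M[C]_2) : x *m x = 1%:M -> y *m y = 1%:M -> z *m z = 1%:M ->
  x *m y = io *: z -> y *m x = - io *: z.
Proof.
move=> xx yy zz xy; have h : (x *m y) *m (y *m x) = 1%:M by rewrite -mulmxA (mulmxA y) yy mul1mx xx.
have : z *m ((x *m y) *m (y *m x)) = z by rewrite h mulmx1.
rewrite xy -scalemxAl -scalemxAr !mulmxA zz mul1mx => e.
by rewrite -e scalerA mulNr ii opprK scale1r.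
Qed.

Variables W Wp Wq Wr : nat -> nat -> nat -> vec.
Hypothesis solW : dirac_sol tp tq tr n sp sq sr W.
Hypothesis WpE : forall a b c, Wp a b c = rot_coef io sp kq kr (fun b c => W a b c) b c.
Hypothesis WqE : forall a b c, Wq a b c = rot_coef io sq kr kp (fun c a => W a b c) c a.
Hypothesis WrE : forall a b c, Wr a b c = rot_coef io sr kp kq (fun a b => W a b c) a b.

Lemma slice_solve a b : dunkl_num kr tr.+1 *: W a b tr.+1 =
  - (dunkl_num kp a.+1 *: (sr *m sp *m W a.+1 b tr) + dunkl_num kq b.+1 *: (sr *m sq *m W a b.+1 tr)).
Proof.
have /(congr1 (mulmx sr)) := solW.2 a b tr.
rewrite !mulmxDr -!scalemxAr !mulmxA srr mul1mx mulmx0 => /eqP.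
by rewrite addrC addr_eq0 => /eqP.
Qed.

Definition step_num a : C := - io * (-1) ^+ a * dunkl_num kp a.+1.

Let pq_sr : sp *m sr *m sq = - io *: 1%:M.
Proof. by rewrite -mulmxA (pauli_swap sqq srr spp sqr) -scalemxAr spp. Qed.
Let p_rp : sp *m sr *m sp = - sr.
Proof. by rewrite -mulmxA srp -scalemxAr spq scalerA ii scaleN1r. Qed.
Let q_rp : sq *m sr *m sp = io *: 1%:M.
Proof. by rewrite sqr -scalemxAl spp. Qed.
Let q_rq : sq *m sr *m sq = - sr.
Proof. by rewrite sqr -scalemxAl spq scalerA ii scaleN1r. Qed.

Lemma sign_b a b : (a + b + tr)%N = n -> (-1) ^+ b = - (-1) ^+ a :> C.
Proof.
move=> e; rewrite -[LHS]signr_odd -[in RHS]signr_odd; have -> : odd b = ~~ odd a by lia.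
by rewrite signrN.
Qed.

(** P reaches the slice tr - 1, where the hypothesis gives 0, and the slice tr + 1, which
    [slice_solve] brings back. One of the two resulting terms has the original exponents, hence only
    two terms remain. *)
Lemma slice_p a b : (a + b + tr)%N = n -> (forall c, c.+1 = tr -> W a b.+1 c = 0) ->
  Wp a b tr = seg_pd kq kr n%:R a *: W a b tr
    + (if b is b'.+1 then step_num a *: (sr *m W a.+1 b' tr) else 0).
Proof.
move=> e z; rewrite WpE /rot_coef.
have -> : (if tr is c'.+1 then dunkl_num kq b.+1 *: W a b.+1 c' else 0) = 0.
  by case: tr z => // c' z; rewrite z ?scaler0.
have bR : b%:R = n%:R - a%:R - tr%:R :> C by rewrite -e !natrD; ring.
have sb := sign_b e.
rewrite exprD -[(-1) ^+ tr]signr_odd or expr1 sb sub0r.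
have T : sp *m (if b is b'.+1 then dunkl_num kr tr.+1 *: W a b' tr.+1 else 0) =
    (if b is b'.+1 then dunkl_num kp a.+1 *: (sr *m W a.+1 b' tr) else 0) + (io * dunkl_num kq b) *: W a b tr.
  case: b {e z bR sb} => [|b]; first by rewrite mulmx0 add0r /dunkl_num expr0 subrr !mulr0 add0r mulr0 scale0r.
  rewrite slice_solve mulmxN mulmxDr -!scalemxAr !mulmxA p_rp pq_sr.
  rewrite mulNmx -scalemxAl mul1mx.
  by move: (sr *m _) => U; apply/colP => k; rewrite !mxE; ring.
rewrite mulmxN T /step_num /seg_pd /dunkl_num sb bR -[(-1) ^+ a]signr_odd.
have -> : (if b is b'.+1 then (- io * (-1) ^+ odd a * (a.+1%:R + kp * (1 - (-1) ^+ a.+1))) *: (sr *m W a.+1 b' tr) else 0)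
   = (- io * (-1) ^+ odd a) *: (if b is b'.+1 then (a.+1%:R + kp * (1 - (-1) ^+ a.+1)) *: (sr *m W a.+1 b' tr) else 0).
  by case: b {e z bR sb T} => [|b]; rewrite ?scaler0 ?scalerA.
move: (if b is b'.+1 then _ else _) => U; rewrite /kval.
apply/colP => k; rewrite !mxE; move: (U k 0) (W a b tr k 0) => u w.
have i2 : io ^+ 2 = -1 by rewrite expr2.
by case: (odd a); rewrite /=; field: i2.
Qed.

(** The hypothesis keeps the Dunkl number: at a + 1 = tp the coefficient of the solution may be
    nonzero, while [tp]_p is 0. *)
Lemma slice_q a b : (a + b + tr)%N = n -> (forall c, c.+1 = tr -> dunkl_num kp a.+1 *: W a.+1 b c = 0) ->
  Wq a b tr = seg_qd kp kr a *: W a b tr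
    + (if a is a'.+1 then (- io * (-1) ^+ a * dunkl_num kq b.+1) *: (sr *m W a' b.+1 tr) else 0).
Proof.
move=> e z; rewrite WqE /rot_coef.
have -> : (if tr is c'.+1 then dunkl_num kp a.+1 *: W a.+1 b c' else 0) = 0.
  by case: tr z => // c' z; rewrite z.
rewrite exprD -[(-1) ^+ tr]signr_odd or expr1 subr0.
have T : sq *m (if a is a'.+1 then dunkl_num kr tr.+1 *: W a' b tr.+1 else 0) =
    (if a is a'.+1 then dunkl_num kq b.+1 *: (sr *m W a' b.+1 tr) else 0) - (io * dunkl_num kp a) *: W a b tr.
  case: a {e z} => [|a]; first by rewrite mulmx0 add0r /dunkl_num expr0 subrr !mulr0 add0r mulr0 scale0r oppr0.
  rewrite slice_solve mulmxN mulmxDr -!scalemxAr !mulmxA q_rp q_rq.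
  rewrite mulNmx -scalemxAl mul1mx.
  by move: (sr *m _) => U; apply/colP => k; rewrite !mxE; ring.
rewrite T /seg_qd /dunkl_num -[(-1) ^+ a]signr_odd.
have -> : (if a is a'.+1 then (- io * (-1) ^+ odd a * (b.+1%:R + kq * (1 - (-1) ^+ b.+1))) *: (sr *m W a' b.+1 tr) else 0)
   = (- io * (-1) ^+ odd a) *: (if a is a'.+1 then (b.+1%:R + kq * (1 - (-1) ^+ b.+1)) *: (sr *m W a' b.+1 tr) else 0).
  by case: a {e z T} => [|a]; rewrite ?scaler0 ?scalerA.
move: (if a is a'.+1 then _ else _) => U; rewrite /kval.
apply/colP => k; rewrite !mxE; move: (U k 0) (W a b tr k 0) => u w.
have i2 : io ^+ 2 = -1 by rewrite expr2.
by case: (odd a); rewrite /=; field: i2.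
Qed.

Lemma slice_r a b : (a + b + tr)%N = n ->
  Wr a b tr = ((-1) ^+ a * (kq - kp) - 2^-1) *: W a b tr
    - io *: (if b is b'.+1 then dunkl_num kp a.+1 *: (sr *m W a.+1 b' tr) else 0)
    + io *: (if a is a'.+1 then dunkl_num kq b.+1 *: (sr *m W a' b.+1 tr) else 0).
Proof.
move=> e; rewrite WrE /rot_coef (sign_b e) exprD (sign_b e) mulrN -expr2 sqrr_sign.
rewrite mulmxBr.
have -> : sr *m (if b is b'.+1 then dunkl_num kp a.+1 *: W a.+1 b' tr else 0) =
   (if b is b'.+1 then dunkl_num kp a.+1 *: (sr *m W a.+1 b' tr) else 0).
  by case: (b) => [|b']; rewrite ?mulmx0 -?scalemxAr.
have -> : sr *m (if a is a'.+1 then dunkl_num kq b.+1 *: W a' b.+1 tr else 0) =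
   (if a is a'.+1 then dunkl_num kq b.+1 *: (sr *m W a' b.+1 tr) else 0).
  by case: (a) => [|a']; rewrite ?mulmx0 -?scalemxAr.
move: (if b is b'.+1 then _ else _) (if a is a'.+1 then _ else _) => U U'.
by apply/colP => k; rewrite !mxE; ring.
Qed.

(** Rescaling the basis alters the two opposite off-diagonal coefficients but not their product,
    which is therefore the subdiagonal of [segQ] once the superdiagonal of [segP] is 1. *)
Lemma seg_phi_steps a b : (a.+1 + b + tr)%N = n ->
  step_num a * (- io * (-1) ^+ a.+1 * dunkl_num kq b.+1) = seg_phi kp kq kr n%:R a.+1.
Proof.
move=> e; have bR : b%:R = n%:R - a%:R - 1 - tr%:R :> C by rewrite -e !natrD -natr1; ring.
have i2 : io ^+ 2 = -1 by rewrite expr2.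
have ob : odd b = odd a by lia.
rewrite /step_num /seg_phi !dunkl_numE /= ob exprS -[(-1) ^+ a]signr_odd -!natr1 bR /kval.
by case: (odd a); rewrite /=; field: i2.
Qed.

Variable a0 : nat.
(* Twisting by these makes the superdiagonal of [segP] equal to 1 and removes
   sigma_r from the action on the slice. *)
Fixpoint twist (j : nat) : 'M[C]_2 :=
  if j is j'.+1 then step_num (a0 + j') *: (twist j' *m sr) else 1%:M.

Variable d : nat.
(** Rows follow the segment, columns the two components of C^2. Since P, Q, R act from the left by
    scalar matrices, each column is one copy of the segment module. *)
Definition slice_coord (V : nat -> nat -> nat -> vec) : 'M[C]_(d.+1, 2) :=
  \matrix_(j < d.+1) (twist j *m V (a0 + j)%N (n - tr - (a0 + j))%N tr)^T.

Hypothesis rng : (a0 + d + tr <= n)%N.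
Hypothesis lower_q : forall j b c, (j <= d)%N -> c.+1 = tr -> W (a0 + j)%N b c = 0.
Hypothesis lower_p : forall j b c, (j <= d)%N -> c.+1 = tr ->
  dunkl_num kp (a0 + j).+1 *: W (a0 + j).+1 b c = 0.
Hypothesis right_end : forall b, (a0 + d + b.+1 + tr)%N = n ->
  dunkl_num kp (a0 + d).+1 *: W (a0 + d).+1 b tr = 0.
Hypothesis left_end : forall a b, a0 = a.+1 -> W a b tr = 0.
Hypothesis phi_lo : seg_phi kp kq kr n%:R a0 = 0.
Hypothesis phi_hi : seg_phi kp kq kr n%:R (a0 + d.+1) = 0.

Let unit_coord (V : nat -> nat -> nat -> vec) j : unit_row C d j *m slice_coord V =
  if (j <= d)%N then (twist j *m V (a0 + j)%N (n - tr - (a0 + j))%N tr)^T else 0.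
Proof. exact: (unit_row_stack _ (fun j => (twist j *m V (a0 + j)%N (n - tr - (a0 + j))%N tr)^T)). Qed.

(** Beyond j = d there is no row, and [right_end] kills the neighbour: in the quotient through
    [tp]_p = 0, in the intersection because the exponent of x_q falls below tq. *)
Let up j : (j <= d)%N ->
  twist j *m (if (n - tr - (a0 + j))%N is b'.+1 then step_num (a0 + j) *: (sr *m W (a0 + j).+1 b' tr) else 0)
  = if (j < d)%N then twist j.+1 *m W (a0 + j.+1)%N (n - tr - (a0 + j.+1))%N tr else 0.
Proof.
move=> jd; case: ltnP => h.
  have -> : (n - tr - (a0 + j) = (n - tr - (a0 + j.+1)).+1)%N by lia.
  by rewrite /= addnS -scalemxAr -scalemxAl mulmxA.
have -> : j = d by apply/eqP; rewrite eqn_leq jd.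
case E : (n - tr - (a0 + d))%N => [|b']; first by rewrite mulmx0.
rewrite /step_num -scalerA scalemxAr right_end ?mulmx0 ?scaler0 ?mulmx0 //; lia.
Qed.

Let down j : (j <= d)%N ->
  twist j *m (if (a0 + j)%N is a'.+1 then (- io * (-1) ^+ (a0 + j) * dunkl_num kq (n - tr - (a0 + j)).+1)
       *: (sr *m W a' (n - tr - (a0 + j)).+1 tr) else 0)
  = if j is j'.+1 then seg_phi kp kq kr n%:R (a0 + j) *: (twist j' *m W (a0 + j')%N (n - tr - (a0 + j'))%N tr) else 0.
Proof.
case: j => [|j] jd.
  rewrite addn0; case E : a0 => [|a']; rewrite ?mulmx0 //.
  by rewrite (left_end _ E) mulmx0 scaler0 mulmx0.
rewrite addnS -(seg_phi_steps (b := (n - tr - (a0 + j).+1)%N)); last by lia.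
have -> : (n - tr - (a0 + j) = (n - tr - (a0 + j).+1).+1)%N by lia.
rewrite /= -scalemxAr -scalemxAl mulmxA -(mulmxA (twist j)) srr mulmx1 scalerA.
by rewrite mulrC.
Qed.

Lemma slice_coordP : slice_coord Wp = segP kq kr n%:R d a0 *m slice_coord W.
Proof.
apply: mx_rowP => j; rewrite mulmxA segP_row mulmxDl -scalemxAl !unit_coord.
case: (leqP j d) => jd; last by rewrite (_ : (j < d)%N = false) ?scaler0 ?addr0 //; lia.
rewrite slice_p; [|lia|by move=> c e; apply: lower_q].
rewrite mulmxDr up // -scalemxAr linearD linearZ /=; congr (_ + _).
by case: ifP => // _; rewrite trmx0.
Qed.

Lemma slice_coordQ : slice_coord Wq = segQ kp kq kr n%:R d a0 *m slice_coord W.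
Proof.
apply: mx_rowP => j; rewrite mulmxA.
have qj : (j <= d)%N -> Wq (a0 + j)%N (n - tr - (a0 + j))%N tr = seg_qd kp kr (a0 + j) *: W (a0 + j)%N (n - tr - (a0 + j))%N tr
    + (if (a0 + j)%N is a'.+1 then (- io * (-1) ^+ (a0 + j) * dunkl_num kq (n - tr - (a0 + j)).+1)
       *: (sr *m W a' (n - tr - (a0 + j)).+1 tr) else 0).
  by move=> jd; rewrite slice_q; [|lia|move=> c e; apply: lower_p].
case: j qj => [|j] qj.
  rewrite segQ_row0 -scalemxAl !unit_coord leq0n qj // mulmxDr (down (leq0n _)) addr0 -scalemxAr linearZ /=.
  by rewrite addn0.
rewrite segQ_row // mulmxDl -!scalemxAl !unit_coord.
case: (leqP j.+1 d) => jd; last first.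
  rewrite scaler0 add0r; case: (leqP j d) => h; last by rewrite scaler0.
  by have -> : j = d by [lia]; rewrite phi_hi scale0r.
by rewrite (ltnW jd) qj // mulmxDr (down jd) -scalemxAr linearD !linearZ.
Qed.

Lemma slice_coordR : slice_coord Wr = segR kp kq kr n%:R d a0 *m slice_coord W.
Proof.
apply: mx_rowP => j; rewrite mulmxA.
have rj : (j <= d)%N -> Wr (a0 + j)%N (n - tr - (a0 + j))%N tr =
      ((-1) ^+ (a0 + j) * (kq - kp) - 2^-1) *: W (a0 + j)%N (n - tr - (a0 + j))%N tr
    + (-1) ^+ (a0 + j) *: (if (n - tr - (a0 + j))%N is b'.+1 then step_num (a0 + j) *: (sr *m W (a0 + j).+1 b' tr) else 0)
    - (-1) ^+ (a0 + j) *: (if (a0 + j)%N is a'.+1 then (- io * (-1) ^+ (a0 + j) * dunkl_num kq (n - tr - (a0 + j)).+1)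
       *: (sr *m W a' (n - tr - (a0 + j)).+1 tr) else 0).
  move=> jd; rewrite slice_r; last by lia.
  move: (a0 + j)%N (n - tr - _)%N => a b; rewrite /step_num.
  have ss : (-1) ^+ a * (-1) ^+ a = 1 :> C by rewrite -expr2 sqrr_sign.
  have sgn x (v : vec) : (-1) ^+ a *: ((- io * (-1) ^+ a * x) *: v) = - (io *: (x *: v)).
    rewrite !scalerA -scaleNr; congr (_ *: _).
    by rewrite -[RHS]mulr1 -[X in _ = _ * X]ss; ring.
  congr (_ + _ + _).
    by case: b => [|b]; rewrite ?scaler0 ?oppr0 ?sgn.
  by case: a {ss} sgn => [|a] sgn; rewrite ?scaler0 ?oppr0 // sgn opprK.
case: j rj => [|j] rj.
  rewrite (segR_row0 phi_lo phi_hi) mulmxDl -!scalemxAl !unit_coord leq0n rj //.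
  rewrite mulmxBr mulmxDr -!scalemxAr (up (leq0n _)) (down (leq0n _)) scaler0 subr0 linearD !linearZ /= addn0.
  by congr (_ + _ *: _); case: ifP => // _; rewrite trmx0.
rewrite (segR_row phi_hi) mulmxBl mulmxDl -!scalemxAl !unit_coord.
case: (leqP j.+1 d) => jd; last first.
  rewrite (_ : (j.+1 < d)%N = false); last by lia.
  rewrite !scaler0 add0r sub0r; case: (leqP j d) => h; last by rewrite scaler0 oppr0.
  by have -> : j = d by [lia]; rewrite phi_hi mulr0 scale0r oppr0.
rewrite (ltnW jd) rj // mulmxBr mulmxDr -!scalemxAr (up jd) (down jd) linearB linearD !linearZ /= scalerA.
by congr (_ + _ *: _ + _); case: ifP => // _; rewrite trmx0.
Qed.
End Slice.
End Coefficients.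

(** * Action on polynomials *)

Section Polynomials.
Variables (R : realType).
Local Notation C := R[i].
Local Notation P := {mpoly C[3]}.
Implicit Types (p : P) (m : 'X_{1..3}) (i : 'I_3).

Lemma mcoeff_sum_supp (f : 'X_{1..3} -> C) p m :
  (\sum_(m' <- msupp p) (f m' * p@_m') *: 'X_[m'])@_m = f m * p@_m.
Proof.
rewrite raddf_sum /=; have [pm|npm] := boolP (m \in msupp p).
  rewrite (bigD1_seq m) ?msupp_uniq //= mcoeffZ mcoeffX eqxx mulr1 big1 ?addr0 // => m' /negbTE ne.
  by rewrite mcoeffZ mcoeffX ne mulr0.
rewrite (memN_msupp_eq0 npm) mulr0 big1_seq // => m' /= h.
by rewrite mcoeffZ mcoeffX; case: eqP h npm => [->->|_ _ _] //; rewrite mulr0.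
Qed.

Lemma mcoeff_refl i p m : (refl i p)@_m = (-1) ^+ (m i) * p@_m.
Proof.
rewrite -(mcoeff_sum_supp (fun m => (-1) ^+ (m i))); congr (_@_m).
rewrite /refl comp_mpolyEX; apply: eq_bigr => m' _.
have -> : 'X_[m'] \mPo [tuple (if j == i then - 'X_j else 'X_j) | j < 3] = (-1) ^+ (m' i) *: 'X_[m'] :> P.
  rewrite comp_mpolyX mpolyXE_id.
  rewrite (eq_bigr (fun j => (if j == i then (-1) ^+ (m' i) else 1) * 'X_j ^+ (m' j) : P)); last first.
    move=> j _; rewrite tnth_mktuple; case: eqP => [->|_]; last by rewrite mul1r.
    exact: exprNn.
  rewrite big_split /= -big_mkcond big_pred1_eq -[(-1) ^+ _ *: _]mul_mpolyC; congr (_ * _).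
  by rewrite rmorphXn rmorphN rmorph1.
by rewrite scalerA mulrC.
Qed.

Lemma mcoeff_divX i p m : (divX i p)@_m = p@_(m + U_(i))%MM.
Proof.
have E : divX i p = \sum_(m' <- msupp p | (0 < m' i)%N) p@_m' *: 'X_[m' - U_(i)] by [].
rewrite E raddf_sum /= big_mkcond /=.
rewrite (eq_bigr (fun m' => p@_m' * (m' == m + U_(i))%MM%:R)); last first.
  move=> m' _; rewrite mcoeffZ mcoeffX; case: ifP => h.
    congr (_ * _%:R); congr nat_of_bool; apply/eqP/eqP => [<-|->]; last by rewrite addmK.
    by rewrite submK //; apply/mnm_lepP => j; rewrite mnm1E; case: eqP => [<-|].
  case: eqP h => [->|]; last by rewrite mulr0.
  by rewrite mnmDE mnm1E eqxx addn1.
have [pm|npm] := boolP ((m + U_(i))%MM \in msupp p).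
  rewrite (bigD1_seq (m + U_(i))%MM) ?msupp_uniq //= eqxx mulr1 big1 ?addr0 // => m' /negbTE ->.
  by rewrite mulr0.
rewrite (memN_msupp_eq0 npm) big1_seq // => m' /= h.
by case: eqP h npm => [->->|_ _ _] //; rewrite mulr0.
Qed.

Lemma mcoeff_dunkl k i p m :
  (dunkl k i p)@_m = dunkl_num (k i)%:C (m i).+1 * p@_(m + U_(i))%MM.
Proof.
rewrite /dunkl mcoeffD mcoeffZ mcoeff_mderiv mcoeff_divX mcoeffB mcoeff_refl.
by rewrite mnmDE mnm1E eqxx addn1 /dunkl_num -mulr_natl; ring.
Qed.

(* Locked because unification would otherwise unfold [refl] and [dunkl]. *)
Fact cf_key : unit. Proof. by []. Qed.
Definition cf (u : V R) m : 'cV[C]_2 :=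
  locked_with cf_key (\col_(j < 2) (if j == 0 then u.1@_m else u.2@_m)).
Lemma cfE u m j : cf u m j 0 = if j == 0 then u.1@_m else u.2@_m.
Proof. by rewrite /cf unlock mxE. Qed.

Lemma cf_vadd u v m : cf (vadd u v) m = cf u m + cf v m.
Proof. by apply/colP => j; rewrite ?(cfE, mxE); case: ifP; rewrite /= mcoeffD. Qed.

Lemma cf_vscale c u m : cf (vscale c u) m = c *: cf u m.
Proof. by apply/colP => j; rewrite ?(cfE, mxE); case: ifP; rewrite /= mcoeffZ. Qed.

Lemma cf_vzero m : cf (vzero R) m = 0.
Proof. by apply/colP => j; rewrite ?(cfE, mxE); case: ifP; rewrite /= mcoeff0. Qed.

Lemma cf_inj u v : (forall m, cf u m = cf v m) -> u = v.
Proof.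
case: u v => [u1 u2] [v1 v2] h; congr pair; apply/mpolyP => m.
  by have /colP/(_ 0) := h m; rewrite !cfE.
by have /colP/(_ 1) := h m; rewrite !cfE.
Qed.

Definition pauli1 : 'M[C]_2 := \matrix_(i, j) (i != j)%:R.
Definition pauli2 : 'M[C]_2 := \matrix_(i, j) (if i == j then 0 else if i == 0 then - 'i else 'i).
Definition pauli3 : 'M[C]_2 := \matrix_(i, j) (if i == j then (if i == 0 then 1 else -1) else 0).

Lemma cf_sig1 u m : cf (sig1 u) m = pauli1 *m cf u m.
Proof.
apply/colP => j; rewrite cfE !mxE !big_ord_recl big_ord0 !mxE !cfE /= addr0.
by case: j => -[|[|]] //= ij; rewrite ?mul0r ?mul1r ?add0r ?addr0.
Qed.
Lemma cf_sig2 u m : cf (sig2 u) m = pauli2 *m cf u m.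
Proof.
apply/colP => j; rewrite cfE !mxE !big_ord_recl big_ord0 !mxE !cfE /= addr0.
by case: j => -[|[|]] //= ij; rewrite ?mul0r ?add0r ?addr0 mcoeffZ.
Qed.
Lemma cf_sig3 u m : cf (sig3 u) m = pauli3 *m cf u m.
Proof.
apply/colP => j; rewrite cfE !mxE !big_ord_recl big_ord0 !mxE !cfE /= addr0.
by case: j => -[|[|]] //= ij; rewrite ?mul0r ?mul1r ?mulN1r ?add0r ?addr0 ?mcoeffN.
Qed.

Lemma sqr_imag : 'i * 'i = -1 :> C.
Proof. by rewrite -expr2 sqr_i. Qed.

Ltac pauli_compute := apply/matrixP => -[[|[|i]] hi] // [[|[|j]] hj] //;
  rewrite !mxE !big_ord_recl big_ord0 !mxE /=;
  rewrite ?(mul0r, mulr0, mul1r, mulr1, add0r, addr0, mulrN, mulNr, mulN1r, oppr0, opprK, sqr_imag).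

Lemma pauli11 : pauli1 *m pauli1 = 1%:M. Proof. by pauli_compute. Qed.
Lemma pauli22 : pauli2 *m pauli2 = 1%:M. Proof. by pauli_compute. Qed.
Lemma pauli33 : pauli3 *m pauli3 = 1%:M. Proof. by pauli_compute. Qed.
Lemma pauli12 : pauli1 *m pauli2 = 'i *: pauli3. Proof. by pauli_compute. Qed.
Lemma pauli23 : pauli2 *m pauli3 = 'i *: pauli1. Proof. by pauli_compute. Qed.
Lemma pauli31 : pauli3 *m pauli1 = 'i *: pauli2. Proof. by pauli_compute. Qed.

Section Monomials.
Variables p q r : 'I_3.
(** Exponents are listed in the order p, q, r, so that permuting the variables amounts to permuting
    arguments. *)
Definition mono (a b c : nat) : 'X_{1..3} := (U_(p) *+ a + U_(q) *+ b + U_(r) *+ c)%MM.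

Lemma mono_Sp a b c : (mono a b c + U_(p) = mono a.+1 b c)%MM.
Proof. by apply/mnmP => i; rewrite !(mnmDE, mulmnE) mulnS; lia. Qed.
Lemma mono_Sq a b c : (mono a b c + U_(q) = mono a b.+1 c)%MM.
Proof. by apply/mnmP => i; rewrite !(mnmDE, mulmnE) mulnS; lia. Qed.
Lemma mono_Sr a b c : (mono a b c + U_(r) = mono a b c.+1)%MM.
Proof. by apply/mnmP => i; rewrite !(mnmDE, mulmnE) mulnS; lia. Qed.

Hypotheses (pq : p != q) (qr : q != r) (pr : p != r).
Lemma mono_p a b c : mono a b c p = a.
Proof.
rewrite !mnmDE !mulmnE !mnm1E eqxx [q == p]eq_sym (negbTE pq) [r == p]eq_sym (negbTE pr).
by rewrite mul1n !mul0n !addn0.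
Qed.
Lemma mono_q a b c : mono a b c q = b.
Proof.
by rewrite !mnmDE !mulmnE !mnm1E eqxx (negbTE pq) [r == q]eq_sym (negbTE qr) mul1n !mul0n addn0.
Qed.
Lemma mono_r a b c : mono a b c r = c.
Proof. by rewrite !mnmDE !mulmnE !mnm1E eqxx (negbTE pr) (negbTE qr) mul1n !mul0n. Qed.

Lemma mcoeff_mulX0 i (f : P) m : m i = 0%N -> (mulX i f)@_m = 0.
Proof.
move=> mi; rewrite /mulX mulrC [f]mpolyE mulr_suml raddf_sum /= big1 // => m' _.
rewrite -scalerAl -mpolyXD mcoeffZ mcoeffX; case: eqP => [e|]; last by rewrite mulr0.
by move: mi; rewrite -e mnmDE mnm1E eqxx addn1.
Qed.

Lemma mcoeff_mulX i (f : P) m : (mulX i f)@_(m + U_(i))%MM = f@_m.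
Proof. by rewrite /mulX mulrC addmC mcoeffMX. Qed.

Lemma mcoeff_angmom k (f : P) a b c : (angmom k r q f)@_(mono a b c) =
  (if c is c'.+1 then dunkl_num (k q)%:C b.+1 * f@_(mono a b.+1 c') else 0)
  - (if b is b'.+1 then dunkl_num (k r)%:C c.+1 * f@_(mono a b' c.+1) else 0).
Proof.
rewrite /angmom mcoeffB; congr (_ - _).
  case: c => [|c]; first by rewrite mcoeff_mulX0 // mono_r.
  by rewrite -mono_Sr mcoeff_mulX mcoeff_dunkl mono_q mono_Sq.
case: b => [|b]; first by rewrite mcoeff_mulX0 // mono_q.
by rewrite -mono_Sq mcoeff_mulX mcoeff_dunkl mono_r mono_Sr.
Qed.

(** Here w is the doubly reflected u, known only through its signs, because the operators X, Y, Z do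
    not all compose their two reflections in the same cyclic order. *)
Lemma cf_rot k sig s (u w : V R) a b c :
  (forall v m, cf (sig v) m = s *m cf v m) ->
  (forall m, cf w m = (-1) ^+ (m q + m r)%N *: cf u m) ->
  cf (vadd (Xpart sig k r q w)
    (vadd (vscale (k q)%:C (vmap (refl r) u)) (vscale (k r)%:C (vmap (refl q) u)))) (mono a b c)
  = rot_coef 'i s (k q)%:C (k r)%:C (fun b c => cf u (mono a b c)) b c.
Proof.
move=> sE wE.
have refl_cf i v m : cf (vmap (refl i) v) m = (-1) ^+ (m i) *: cf v m.
  by apply/colP => j; rewrite ?(cfE, mxE); case: ifP; rewrite /= mcoeff_refl.
have ang : cf (vmap (angmom k r q) w) (mono a b c) =
    (if c is c'.+1 then dunkl_num (k q)%:C b.+1 *: cf w (mono a b.+1 c') else 0)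
  - (if b is b'.+1 then dunkl_num (k r)%:C c.+1 *: cf w (mono a b' c.+1) else 0).
  apply/colP => j; rewrite cfE.
  have E (f : P) : (angmom k r q f)@_(mono a b c) = _ := mcoeff_angmom k f a b c.
  case: (b) (c) E => [|b'] [|c'] E; rewrite !(cfE, mxE); by case: ifP => _; rewrite E.
have -> : cf (vadd (Xpart sig k r q w)
      (vadd (vscale (k q)%:C (vmap (refl r) u)) (vscale (k r)%:C (vmap (refl q) u)))) (mono a b c) =
    ('i *: cf (sig (vmap (angmom k r q) w)) (mono a b c) + 2^-1 *: cf w (mono a b c))
    + ((k q)%:C *: ((-1) ^+ (mono a b c r) *: cf u (mono a b c)) + (k r)%:C *: ((-1) ^+ (mono a b c q) *: cf u (mono a b c))).
  apply: etrans (cf_vadd _ _ _) _; congr (_ + _); apply: etrans (cf_vadd _ _ _) _; congr (_ + _);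
    by apply: etrans (cf_vscale _ _ _) _; congr (_ *: _); exact: refl_cf.
rewrite sE ang.
rewrite (wE (mono a b c)) mono_q mono_r /rot_coef.
have -> : (if c is c'.+1 then dunkl_num (k q)%:C b.+1 *: cf w (mono a b.+1 c') else 0)
   = (-1) ^+ (b + c)%N *: (if c is c'.+1 then dunkl_num (k q)%:C b.+1 *: cf u (mono a b.+1 c') else 0).
  case: (c) => [|c']; first by rewrite scaler0.
  by rewrite wE mono_q mono_r addSnnS !scalerA mulrC.
have -> : (if b is b'.+1 then dunkl_num (k r)%:C c.+1 *: cf w (mono a b' c.+1) else 0)
   = (-1) ^+ (b + c)%N *: (if b is b'.+1 then dunkl_num (k r)%:C c.+1 *: cf u (mono a b' c.+1) else 0).
  case: (b) => [|b']; first by rewrite scaler0.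
  by rewrite wE mono_q mono_r -addSnnS !scalerA mulrC.
rewrite -scalerBr -scalemxAr scalerDr scalerDl !scalerA -!addrA; congr (_ *: _ + (_ *: _ + _)).
- by rewrite mulrC.
- by rewrite mulrC.
Qed.
End Monomials.

Lemma mono_rot (p q r : 'I_3) a b c : mono p q r a b c = mono q r p b c a.
Proof. by rewrite /mono -addmA addmC. Qed.
Lemma mono_swap (p q r : 'I_3) a b c : mono p q r a b c = mono q p r b a c.
Proof. by rewrite /mono [(U_(p) *+ a + _)%MM]addmC. Qed.

Lemma cf_opX k u a b c : cf (opX k u) (mono 0 1 2 a b c) =
  rot_coef 'i pauli1 (k 1)%:C (k 2)%:C (fun b c => cf u (mono 0 1 2 a b c)) b c.
Proof.
apply: cf_rot => // [|m]; first exact: cf_sig1.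
by apply/colP => j; rewrite ?(cfE, mxE); case: ifP => _ /=; rewrite !mcoeff_refl exprD mulrA.
Qed.

Lemma cf_opY k u a b c : cf (opY k u) (mono 1 2 0 a b c) =
  rot_coef 'i pauli2 (k 2)%:C (k 0)%:C (fun b c => cf u (mono 1 2 0 a b c)) b c.
Proof.
apply: cf_rot => // [|m]; first exact: cf_sig2.
by apply/colP => j; rewrite ?(cfE, mxE); case: ifP => _ /=; rewrite !mcoeff_refl exprD mulrA [_ ^+ _ * _ ^+ _]mulrC.
Qed.

Lemma cf_opZ k u a b c : cf (opZ k u) (mono 2 0 1 a b c) =
  rot_coef 'i pauli3 (k 0)%:C (k 1)%:C (fun b c => cf u (mono 2 0 1 a b c)) b c.
Proof.
apply: cf_rot => // [|m]; first exact: cf_sig3.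
by apply/colP => j; rewrite ?(cfE, mxE); case: ifP => _ /=; rewrite !mcoeff_refl exprD mulrA.
Qed.

Lemma cf_Dirac k u a b c : cf (Dirac k u) (mono 0 1 2 a b c) =
  dunkl_num (k 0)%:C a.+1 *: (pauli1 *m cf u (mono 0 1 2 a.+1 b c))
  + dunkl_num (k 1)%:C b.+1 *: (pauli2 *m cf u (mono 0 1 2 a b.+1 c))
  + dunkl_num (k 2)%:C c.+1 *: (pauli3 *m cf u (mono 0 1 2 a b c.+1)).
Proof.
have dk i m : cf (vmap (dunkl k i) u) m = dunkl_num (k i)%:C (m i).+1 *: cf u (m + U_(i))%MM.
  by apply/colP => j; rewrite ?(cfE, mxE); case: ifP => _ /=; rewrite mcoeff_dunkl.
set m := mono 0 1 2 a b c.
have -> : cf (Dirac k u) m = pauli1 *m (dunkl_num (k 0)%:C (m 0%R).+1 *: cf u (m + U_(0%R))%MM)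
    + (pauli2 *m (dunkl_num (k 1)%:C (m 1%R).+1 *: cf u (m + U_(1%R))%MM)
    + pauli3 *m (dunkl_num (k 2)%:C (m 2%R).+1 *: cf u (m + U_(2%R))%MM)).
  apply: etrans (cf_vadd _ _ _) _; congr (_ + _).
    by apply: etrans (cf_sig1 _ _) _; congr (_ *m _); exact: dk.
  apply: etrans (cf_vadd _ _ _) _; congr (_ + _).
    by apply: etrans (cf_sig2 _ _) _; congr (_ *m _); exact: dk.
  by apply: etrans (cf_sig3 _ _) _; congr (_ *m _); exact: dk.
by rewrite /m mono_Sp mono_Sq mono_Sr mono_p // mono_q // mono_r // -!scalemxAr addrA.
Qed.

Lemma mono_surj m : m = mono 0 1 2 (m 0) (m 1) (m 2).
Proof.
apply/mnmP => i; rewrite !mnmDE !mulmnE !mnm1E.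
by case: i => [[|[|[|i]]] hi] //=; rewrite ?mul0n ?mul1n ?addn0 ?add0n; congr (m _); apply: val_inj.
Qed.

Definition of_coef (n : nat) (W : nat -> nat -> nat -> 'cV[C]_2) : V R :=
  (\sum_(m : 'X_{1..3 < n.+1}) W (m 0%R) (m 1%R) (m 2%R) 0 0 *: 'X_[m],
   \sum_(m : 'X_{1..3 < n.+1}) W (m 0%R) (m 1%R) (m 2%R) 1 0 *: 'X_[m]).

Lemma cf_of_coef n W a b c : (forall a b c, (a + b + c)%N <> n -> W a b c = 0) ->
  cf (of_coef n W) (mono 0 1 2 a b c) = W a b c.
Proof.
move=> h; apply/colP => j; rewrite cfE /of_coef /=.
have md : mdeg (mono 0 1 2 a b c) = (a + b + c)%N.
  by rewrite !mdegD !mdegMn !mdeg1 !mul1n.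
have E (i : 'I_2) : (\sum_(m : 'X_{1..3 < n.+1}) W (m 0%R) (m 1%R) (m 2%R) i 0 *: 'X_[m])@_(mono 0 1 2 a b c) = W a b c i 0.
  have [lt|ge] := ltnP (mdeg (mono 0 1 2 a b c)) n.+1.
    by rewrite (mcoeff_mpoly (fun m => W (m 0%R) (m 1%R) (m 2%R) i 0)) // mono_p // mono_q // mono_r.
  rewrite h; last by move: ge; rewrite md; lia.
  rewrite mxE raddf_sum /= big1 // => m _; rewrite mcoeffZ mcoeffX.
  case: eqP => [e|]; last by rewrite mulr0.
  by have := bmdeg m; rewrite e ltnNge ge.
by case: j => -[|[|]] // hj; rewrite !E; congr (W a b c _ _); apply: val_inj.
Qed.
End Polynomials.

(** * The quotients of M_n *)

Section Homs.
Variables (R : realType) (k : 'I_3 -> R).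
Local Notation C := R[i].
Local Notation V := (V R).

Definition bi_hom (U : V -> Prop) (W : bimod R) (f : V -> 'cV[C]_(bdim W)) :=
  (forall c u v, U u -> U v -> f (vadd (vscale c u) v) = c *: f u + f v) /\
  (forall u, U u -> [/\ f (opX k u) = bX W *m f u, f (opY k u) = bY W *m f u & f (opZ k u) = bZ W *m f u]).

Lemma bi_hom_dsum U W W' f f' : bi_hom U f -> bi_hom U f' ->
  @bi_hom U (dsum W W') (fun u => col_mx (f u) (f' u)).
Proof.
move=> [l h] [l' h']; split=> [c u v Uu Uv|u Uu].
  by rewrite l // l' // scale_col_mx add_col_mx.
have [hX hY hZ] := h u Uu; have [hX' hY' hZ'] := h' u Uu.
by split; rewrite [RHS]mul_block_col !mul0mx addr0 add0r;
  [rewrite hX hX'|rewrite hY hY'|rewrite hZ hZ'].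
Qed.

Lemma bi_hom_sub (U U' : V -> Prop) W f : (forall u, U' u -> U u) -> bi_hom U f -> @bi_hom U' W f.
Proof.
move=> s [l h]; split=> [c u v Uu Uv|u Uu]; first by apply: l; apply: s.
exact: h (s _ Uu).
Qed.

(** The two columns of g become the two summands. Surjectivity is stated through a target G for g,
    so that a preimage can later be chosen subject to further conditions. *)
Lemma bi_hom_iso U W (X Y Z : 'M[C]_(bdim W)) (g : V -> 'M[C]_(bdim W, 2)) :
  bi_iso X Y Z ->
  (forall c u v, g (vadd (vscale c u) v) = c *: g u + g v) ->
  (forall u, U u -> [/\ g (opX k u) = X *m g u, g (opY k u) = Y *m g u & g (opZ k u) = Z *m g u]) ->
  exists f : V -> 'cV[C]_(bdim (dsum W W)),
    [/\ bi_hom U f, forall u, f u = 0 <-> g u = 0 & forall w, exists G, forall u, g u = G -> f u = w].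
Proof.
move=> [S [uS SX SY SZ]] gl gh.
exists (fun u => col_mx (S *m col 0 (g u)) (S *m col 1 (g u))); split.
- have H j : @bi_hom U W (fun u => S *m col j (g u)).
    split=> [c u v _ _|u Uu]; first by rewrite gl linearD linearZ /= mulmxDr scalemxAr.
    have [gX gY gZ] := gh u Uu; split.
    - by rewrite gX !colE !mulmxA SX.
    - by rewrite gY !colE !mulmxA SY.
    by rewrite gZ !colE !mulmxA SZ.
  by apply: bi_hom_dsum; apply: H.
- move=> u; split=> [h|->]; last by rewrite !colE !mul0mx !mulmx0 col_mx0.
  have {h} [h0 h1] : S *m col 0 (g u) = 0 /\ S *m col 1 (g u) = 0.
    by apply: eq_col_mx; rewrite col_mx0.
  have e j : S *m col j (g u) = 0 -> col j (g u) = 0.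
    by move=> h; rewrite -(mulKmx uS (col j (g u))) h mulmx0.
  apply/matrixP => i j; rewrite mxE; move/e/colP/(_ i): h0; move/e/colP/(_ i): h1.
  rewrite !mxE; case: j => -[|[|]] // hj h1 h0; [rewrite -[RHS]h0|rewrite -[RHS]h1];
    by congr (g u _ _); apply: val_inj.
move=> w; pose n := bdim W; pose w' : 'cV[C]_(n + n) := w.
exists (row_mx (invmx S *m usubmx w') (invmx S *m dsubmx w')) => u ->.
set A := invmx S *m usubmx w'; set B := invmx S *m dsubmx w'.
have -> : col 0 (row_mx A B) = A.
  apply/colP => i; rewrite mxE; transitivity (row_mx A B i (lshift 1 0)); last exact: row_mxEl.
  by congr (fun_of_matrix (row_mx A B) i); apply: val_inj.
have -> : col 1 (row_mx A B) = B.
  apply/colP => i; rewrite mxE; transitivity (row_mx A B i (rshift 1 0)); last exact: row_mxEr.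
  by congr (fun_of_matrix (row_mx A B) i); apply: val_inj.
by rewrite !mulKVmx // vsubmxK.
Qed.

End Homs.

Lemma I3_cases (p q r i : 'I_3) : p != q -> q != r -> p != r -> [|| i == p, i == q | i == r].
Proof.
by case: i p q r => [[|[|[|i]]] hi] // [[|[|[|p]]] hp] // [[|[|[|q]]] hq] // [[|[|[|r]]] hr].
Qed.

(** * Kernels and images of the segment coordinates, for an arbitrary order of the variables *)

Section Perm.
Variable R : realType.
Local Notation C := R[i].
Local Notation V := (V R).
Variables (k : 'I_3 -> R) (n : nat) (p q r : 'I_3) (tp tq tr : nat) (sp sq sr : 'M[C]_2) (io : C).
Variables (oP oQ oR : V -> V).
Local Notation kp := (kval R tp).
Local Notation kq := (kval R tq).
Local Notation kr := (kval R tr).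
Hypotheses (op : odd tp) (oq : odd tq) (or : odd tr) (ev : ~~ odd n) (le : (tp + tq + tr <= n)%N).
Hypotheses (spp : sp *m sp = 1%:M) (sqq : sq *m sq = 1%:M) (srr : sr *m sr = 1%:M).
Hypotheses (ii : io * io = -1).
Hypotheses (spq : sp *m sq = io *: sr) (sqr : sq *m sr = io *: sp) (srp : sr *m sp = io *: sq).
Local Notation W u := (fun a b c => cf u (mono p q r a b c)).
Hypothesis pqr : [/\ p != q, q != r & p != r].
Hypothesis Mn_sol : forall u, Mn k n u <-> dirac_sol tp tq tr n sp sq sr (W u).
Hypothesis sol_Mn : forall w, dirac_sol tp tq tr n sp sq sr w ->
  exists2 u, Mn k n u & forall a b c, W u a b c = w a b c.
Hypothesis oPE : forall u a b c, W (oP u) a b c = rot_coef io sp kq kr (fun b c => W u a b c) b c.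
Hypothesis oQE : forall u a b c, W (oQ u) a b c = rot_coef io sq kr kp (fun c a => W u a b c) c a.
Hypothesis oRE : forall u a b c, W (oR u) a b c = rot_coef io sr kp kq (fun a b => W u a b c) a b.

Lemma mono_surj_pqr (m : 'X_{1..3}) : m = mono p q r (m p) (m q) (m r).
Proof.
have [pq qr pr] := pqr; apply/mnmP => i; rewrite !mnmDE !mulmnE !mnm1E.
have : [|| i == p, i == q | i == r].
  exact: I3_cases.
case/or3P => /eqP ->.
- by rewrite eqxx [q == p]eq_sym (negbTE pq) [r == p]eq_sym (negbTE pr) mul1n !mul0n !addn0.
- by rewrite eqxx (negbTE pq) [r == q]eq_sym (negbTE qr) mul1n !mul0n addn0.
by rewrite eqxx (negbTE pr) (negbTE qr) mul1n !mul0n.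
Qed.

Lemma Mnx_cf i t u : Mnx k n i t u <-> Mn k n u /\ forall m : 'X_{1..3}, (m i < t)%N -> cf u m = 0.
Proof.
split=> [[h [d1 d2]]|[h z]]; split=> //.
  have H (f : {mpoly C[3]}) : divisible_from i t f -> forall m : 'X_{1..3}, (m i < t)%N -> f@_m = 0.
    move=> /allP df m mt; apply/eqP; rewrite mcoeff_eq0; apply/negP => /df.
    by rewrite leqNgt mt.
  by move=> m mt; apply/colP => j; rewrite cfE mxE; case: ifP => _; apply: H mt.
split; apply/allP => m; rewrite mcoeff_msupp leqNgt; apply: contraNN => /z /colP z'.
  by have := z' 0; rewrite cfE mxE /= => ->.
by have := z' 1; rewrite cfE mxE /= => ->.
Qed.

Lemma Mnx_p t u : Mnx k n p t u <-> Mn k n u /\ forall a b c, (a < t)%N -> W u a b c = 0.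
Proof.
have [pq qr pr] := pqr; rewrite Mnx_cf; split=> -[h z]; split=> //.
  by move=> a b c h'; apply: z; rewrite mono_p.
by move=> m h'; rewrite (mono_surj_pqr m); apply: z.
Qed.
Lemma Mnx_q t u : Mnx k n q t u <-> Mn k n u /\ forall a b c, (b < t)%N -> W u a b c = 0.
Proof.
have [pq qr pr] := pqr; rewrite Mnx_cf; split=> -[h z]; split=> //.
  by move=> a b c h'; apply: z; rewrite mono_q.
by move=> m h'; rewrite (mono_surj_pqr m); apply: z.
Qed.
Lemma Mnx_r t u : Mnx k n r t u <-> Mn k n u /\ forall a b c, (c < t)%N -> W u a b c = 0.
Proof.
have [pq qr pr] := pqr; rewrite Mnx_cf; split=> -[h z]; split=> //.
  by move=> a b c h'; apply: z; rewrite mono_r.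
by move=> m h'; rewrite (mono_surj_pqr m); apply: z.
Qed.

Definition seg_coord (d a0 : nat) (u : V) := slice_coord tp tr n sr io a0 d (W u).

Lemma seg_coord_lin d a0 c u v :
  seg_coord d a0 (vadd (vscale c u) v) = c *: seg_coord d a0 u + seg_coord d a0 v.
Proof.
apply/row_matrixP => j; rewrite linearD linearZ /= !rowK cf_vadd cf_vscale.
by rewrite mulmxDr -scalemxAr linearD linearZ.
Qed.

(** The segment 0, ..., tp - 1 closes on the right because [tp]_p = 0, and the slice tr - 1 vanishes
    over it by [support_pr]. *)
Lemma quotient_coord u : Mn k n u -> let g := seg_coord tp.-1 0 in
  [/\ g (oP u) = segP kq kr n%:R tp.-1 0 *m g u,
      g (oQ u) = segQ kp kq kr n%:R tp.-1 0 *m g u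
    & g (oR u) = segR kp kq kr n%:R tp.-1 0 *m g u].
Proof.
move=> /Mn_sol sol g; have tp0 := odd_gt0 op.
have lo := seg_phi0 R tp tq tr n; have hi := @seg_phi_pred R tp tq tr n op.
have rng : (0 + tp.-1 + tr <= n)%N by lia.
have l1 j b c : (j <= tp.-1)%N -> c.+1 = tr -> W u (0 + j)%N b c = 0.
  by move=> h e; apply: (support_pr op oq or sqq sol) => //; lia.
have l2 j b c : (j <= tp.-1)%N -> c.+1 = tr -> dunkl_num kp (0 + j).+1 *: W u (0 + j).+1 b c = 0.
  move=> h e; have [->|ne] := eqVneq (0 + j).+1 tp; first by rewrite dunkl_num_t // scale0r.
  by rewrite (support_pr op oq or sqq sol) ?scaler0 //; lia.
have l3 b : (0 + tp.-1 + b.+1 + tr)%N = n -> dunkl_num kp (0 + tp.-1).+1 *: W u (0 + tp.-1).+1 b tr = 0.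
  by move=> _; rewrite add0n prednK // dunkl_num_t // scale0r.
have l4 (a b : nat) : 0%N = a.+1 -> W u a b tr = 0 by [].
split.
- exact: (slice_coordP op oq or ev spp sqq srr ii spq sqr srp sol (oPE u) rng l1 l3).
- exact: (slice_coordQ op oq or ev spp srr ii spq sqr sol (oQE u) rng l2 l4 hi).
exact: (slice_coordR op oq or ev srr ii (oRE u) rng l3 l4 lo hi).
Qed.

(** The segment tp, ..., n - tq - tr closes by vanishing: on the left in M_n(x_p), on the right in
    M_n(x_q), and below the slice in M_n(x_r). *)
Lemma sub_coord u : Mnx k n p tp u -> Mnx k n q tq u -> Mnx k n r tr u ->
  let d := (n - (tp + tq + tr))%N in let g := seg_coord d tp in
  [/\ g (oP u) = segP kq kr n%:R d tp *m g u,
      g (oQ u) = segQ kp kq kr n%:R d tp *m g u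
    & g (oR u) = segR kp kq kr n%:R d tp *m g u].
Proof.
move=> /Mnx_p[/Mn_sol sol zp] /Mnx_q[_ zq] /Mnx_r[_ zr] d g.
have lo := @seg_phi_tp R tp tq tr n op; have hi := @seg_phi_end R tp tq tr n op oq or ev le.
have rng : (tp + d + tr <= n)%N by rewrite /d; lia.
have l1 j b c : (j <= d)%N -> c.+1 = tr -> W u (tp + j)%N b c = 0.
  by move=> h e; apply: zr; lia.
have l2 j b c : (j <= d)%N -> c.+1 = tr -> dunkl_num kp (tp + j).+1 *: W u (tp + j).+1 b c = 0.
  by move=> h e; rewrite zr ?scaler0 //; lia.
have l3 b : (tp + d + b.+1 + tr)%N = n -> dunkl_num kp (tp + d).+1 *: W u (tp + d).+1 b tr = 0.
  by rewrite /d => e; rewrite zq ?scaler0 //; lia.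
have l4 a b : tp = a.+1 -> W u a b tr = 0 by move=> e; apply: zp; lia.
split.
- exact: (slice_coordP op oq or ev spp sqq srr ii spq sqr srp sol (oPE u) rng l1 l3).
- exact: (slice_coordQ op oq or ev spp srr ii spq sqr sol (oQE u) rng l2 l4 hi).
exact: (slice_coordR op oq or ev srr ii (oRE u) rng l3 l4 lo hi).
Qed.

(** The only step that is not invertible leads from exponent tp - 1 to tp, where [tp]_p = 0. *)
Lemma twist_unit a0 j : (forall l, (l < j)%N -> (a0 + l).+1 != tp) -> twist tp sr io a0 j \in unitmx.
Proof.
have usr : sr \in unitmx by have := unitmx1 C 2; rewrite -srr unitmx_mul => /andP[].
have io0 : io != 0 by apply/eqP => e; move/eqP: ii; rewrite e mul0r eq_sym oppr_eq0 oner_eq0.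
elim: j => [|j IH] h /=; first exact: unitmx1.
rewrite unitmxZ ?unitmx_mul ?usr ?IH // => [l lj|]; first by apply: h; apply: ltnW.
by rewrite unitfE /step_num !mulf_neq0 ?oppr_eq0 ?signr_eq0 // dunkl_num_neq0 // h.
Qed.

Lemma seg_coord0 d a0 u : (forall l, (l < d)%N -> (a0 + l).+1 != tp) ->
  seg_coord d a0 u = 0 -> forall j, (j <= d)%N -> W u (a0 + j)%N (n - tr - (a0 + j))%N tr = 0.
Proof.
move=> h e j jd; have := congr1 (row (Ordinal (jd : (j < d.+1)%N))) e.
rewrite rowK row0 /= => /(congr1 trmx); rewrite trmxK trmx0 => e'.
have ut : twist tp sr io a0 j \in unitmx.
  by apply: twist_unit => l lj; apply: h; apply: leq_trans lj jd.
by rewrite -[LHS](mulKmx ut) e' mulmx0.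
Qed.

Lemma quotient_kernel u : Mn k n u -> seg_coord tp.-1 0 u = 0 <-> Mnx k n p tp u.
Proof.
move=> Mu; have sol := (Mn_sol u).1 Mu; have tp0 := odd_gt0 op; split=> [e|/Mnx_p[_ z]].
  apply/Mnx_p; split=> //; apply: (slice_kernel_p op oq or sqq srr sol le) => a b ap.
  have [eab|ne] := eqVneq (a + b + tr)%N n; last by apply: sol.1; apply/eqP.
  have := seg_coord0 _ e (j := a); rewrite !add0n => /(_ _ _).
  have -> : (n - tr - a)%N = b by lia.
  by apply; [move=> l; lia|lia].
by apply/row_matrixP => j; rewrite rowK row0 z ?mulmx0 ?trmx0 //; have := ltn_ord j; lia.
Qed.

Lemma sub_kernel u : Mnx k n p tp u -> Mnx k n q tq u -> Mnx k n r tr u ->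
  seg_coord (n - (tp + tq + tr)) tp u = 0 <-> u = vzero R.
Proof.
move=> /Mnx_p[/Mn_sol sol zp] /Mnx_q[_ zq] /Mnx_r[_ zr]; split=> [e|->]; last first.
  by apply/row_matrixP => j; rewrite rowK row0 cf_vzero mulmx0 trmx0.
apply: cf_inj => m; rewrite (mono_surj_pqr m) cf_vzero.
apply: (slice_kernel0 or srr sol zr) => a b.
have [eab|ne] := eqVneq (a + b + tr)%N n; last by apply: sol.1; apply/eqP.
have [lt|ge] := ltnP a tp; first exact: zp.
have [lt|ge'] := ltnP b tq; first exact: zq.
have := seg_coord0 _ e (j := (a - tp)%N).
have -> : (tp + (a - tp) = a)%N by lia.
have -> : (n - tr - a)%N = b by lia.
by apply; [move=> l; lia|lia].
Qed.

Lemma slice_ex (g : nat -> 'cV[C]_2) : exists u, [/\ Mn k n u,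
  forall a b, (a + b + tr)%N = n -> W u a b tr = g a & Mnx k n r tr u].
Proof.
have sol := slice_solP n sp sq op oq or srr g.
have [u Mu E] := sol_Mn sol.
exists u; split=> // [a b e|]; first by rewrite E slice_sol_slice.
by apply/Mnx_r; split=> // a b c h; rewrite E slice_sol_lt.
Qed.

Lemma slice_target d a0 (G : 'M[C]_(d.+1, 2)) : (forall l, (l < d)%N -> (a0 + l).+1 != tp) ->
  (a0 + d + tr <= n)%N ->
  exists u, [/\ Mn k n u, seg_coord d a0 u = G, Mnx k n r tr u
    & forall a b, (a < a0)%N || (a0 + d < a)%N -> W u a b tr = 0].
Proof.
(* The prescribed rows are untwisted on the segment; the zeros outside it later put u into further
   submodules. *)
move=> h rng; pose g a : 'cV[C]_2 := if (a < a0)%N || (a0 + d < a)%N then 0 else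
   invmx (twist tp sr io a0 (a - a0)) *m (row (inord (a - a0)) G)^T.
have [u [Mu ug ur]] := slice_ex g; have sol := (Mn_sol u).1 Mu.
exists u; split=> // [|a b out]; last first.
  have [eab|ne] := eqVneq (a + b + tr)%N n; last by apply: sol.1; apply/eqP.
  by rewrite ug // /g out.
apply/row_matrixP => j; rewrite rowK; have jd := ltn_ord j.
rewrite ug; last by lia.
have -> : g (a0 + j)%N = invmx (twist tp sr io a0 j) *m (row j G)^T.
  have c : ((a0 + j < a0) || (a0 + d < a0 + j))%N = false by lia.
  by rewrite /g c addKn inord_val.
rewrite mulKVmx ?trmxK //; apply: twist_unit => l lj; apply: h; lia.
Qed.

(** If b < tq, then a = n - tr - b lies beyond the segment, where the slice is 0; [slice_kernel_p]
    with p and q exchanged then gives membership in M_n(x_q). *)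
Lemma quotient_surj (G : 'M[C]_(tp.-1.+1, 2)) : exists u,
  [/\ Mn k n u, seg_coord tp.-1 0 u = G, Mnx k n q tq u & Mnx k n r tr u].
Proof.
have tp0 := odd_gt0 op.
have [||u [Mu uG ur z]] := @slice_target _ 0 G; [by move=> l; lia|by lia|].
exists u; split=> //; apply/Mnx_q; split=> // a b c h.
have sol := dirac_sol_swap ((Mn_sol u).1 Mu).
apply: (slice_kernel_p oq op or spp srr sol _ _ _ _ h); first by rewrite (addnC tq).
move=> b' a' hb; have [eab|ne] := eqVneq (a' + b' + tr)%N n; first by apply: z; lia.
by apply: ((Mn_sol u).1 Mu).1; apply/eqP.
Qed.

Lemma sub_surj (G : 'M[C]_((n - (tp + tq + tr)).+1, 2)) : exists u,
  [/\ Mnx k n p tp u, Mnx k n q tq u, Mnx k n r tr u & seg_coord (n - (tp + tq + tr)) tp u = G].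
Proof.
have [||u [Mu uG ur z]] := @slice_target _ tp G; [by move=> l; lia|by lia|].
have sol := (Mn_sol u).1 Mu.
exists u; split=> //.
  apply/Mnx_p; split=> // a b c h.
  by apply: (slice_kernel_p op oq or sqq srr sol le _ _ _ h) => a' b' h'; apply: z; rewrite h'.
apply/Mnx_q; split=> // a b c h.
apply: (slice_kernel_p oq op or spp srr (dirac_sol_swap sol) _ _ _ _ h); first by rewrite (addnC tq).
move=> b' a' hb; have [eab|ne] := eqVneq (a' + b' + tr)%N n; first by apply: z; lia.
by apply: sol.1; apply/eqP.
Qed.
End Perm.

(** * The three permutations and the assembly of the isomorphisms *)

Section Assembly.
Variable R : realType.
Local Notation C := R[i].
Local Notation V := (V R).
Local Notation kval := (kval R).

Lemma dirac_sol_ext tp tq tr n (sp sq sr : 'M[C]_2) W W' : (forall a b c, W a b c = W' a b c) ->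
  dirac_sol tp tq tr n sp sq sr W -> dirac_sol tp tq tr n sp sq sr W'.
Proof. by move=> e [h1 h2]; split=> a b c; rewrite -!e //; apply: h1. Qed.

Lemma dirac_sol_lin tp tq tr n (sp sq sr : 'M[C]_2) x W W' :
  dirac_sol tp tq tr n sp sq sr W -> dirac_sol tp tq tr n sp sq sr W' ->
  dirac_sol tp tq tr n sp sq sr (fun a b c => x *: W a b c + W' a b c).
Proof.
move=> [h1 h2] [h1' h2']; split=> a b c; first by move=> ne; rewrite h1 // h1' // scaler0 addr0.
rewrite -[RHS](addr0 0) -[X in _ = X + _](scaler0 _ x) -[X in _ = x *: X + _](h2 a b c) -[X in _ = _ + X](h2' a b c).
rewrite !mulmxDr -!scalemxAr.
move: (sp *m W _ _ _) (sq *m W _ _ _) (sr *m W _ _ _) (sp *m W' _ _ _) (sq *m W' _ _ _) (sr *m W' _ _ _).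
by move=> u1 u2 u3 v1 v2 v3; apply/colP => j; rewrite !mxE; ring.
Qed.

Lemma rot_coef_ext i s kb kd (W W' : nat -> nat -> 'cV[C]_2) b c : (forall b c, W b c = W' b c) ->
  rot_coef i s kb kd W b c = rot_coef i s kb kd W' b c.
Proof. by move=> e; rewrite /rot_coef e; case: b c => [|b] [|c]; rewrite ?e. Qed.

Lemma mono_rev (p q r : 'I_3) a b c : mono p q r a b c = mono r q p c b a.
Proof. by rewrite mono_swap mono_rot mono_rot. Qed.

(** Stated for any order of the variables: it is checked once for the identity and carried to the
    orders used for B and C. *)
Definition coef_data (k : 'I_3 -> R) n p q r tp tq tr (sp sq sr : 'M[C]_2) :=
  (forall u, Mn k n u <-> dirac_sol tp tq tr n sp sq sr (fun a b c => cf u (mono p q r a b c))) /\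
  (forall w, dirac_sol tp tq tr n sp sq sr w ->
    exists2 u, Mn k n u & forall a b c, cf u (mono p q r a b c) = w a b c).

Lemma coef_data_swap k n p q r tp tq tr sp sq sr : coef_data k n p q r tp tq tr sp sq sr ->
  coef_data k n q p r tq tp tr sq sp sr.
Proof.
move=> [h1 h2]; split=> [u|w sol].
  rewrite h1; split=> /dirac_sol_swap; apply: dirac_sol_ext => a b c;
  by rewrite mono_swap.
have [u Mu e] := h2 _ (dirac_sol_swap sol).
by exists u => // a b c; rewrite mono_swap e.
Qed.

Lemma coef_data_rot k n p q r tp tq tr sp sq sr : coef_data k n p q r tp tq tr sp sq sr ->
  coef_data k n q r p tq tr tp sq sr sp.
Proof.
move=> [h1 h2]; split=> [u|w sol].
  rewrite h1; split=> [/dirac_sol_rot|/dirac_sol_rot/dirac_sol_rot]; apply: dirac_sol_ext => a b c.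
    by rewrite mono_rot.
  by rewrite -mono_rot.
have [u Mu e] := h2 _ (dirac_sol_rot (dirac_sol_rot sol)).
by exists u => // a b c; rewrite -mono_rot e.
Qed.

Lemma is_homog_mcoeff n (p : {mpoly C[3]}) :
  is_homog n p <-> forall m : 'X_{1..3}, mdeg m <> n -> p@_m = 0.
Proof.
split=> [/allP h m /eqP ne|h].
  by apply/eqP; rewrite mcoeff_eq0; apply: contraNN ne => /h.
by apply/allP => m; rewrite mcoeff_msupp; apply: contraNT => /eqP ne; apply/eqP/h.
Qed.

Section Main.
Variables (k1 k2 k3 : R) (t1 t2 t3 n : nat).
Local Notation k := (kvec k1 k2 k3).
Hypotheses (e1 : k1%:C = kval t1) (e2 : k2%:C = kval t2) (e3 : k3%:C = kval t3).

Lemma coef_data012 : coef_data k n 0 1 2 t1 t2 t3 (pauli1 R) (pauli2 R) (pauli3 R).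
Proof.
have md a b c : mdeg (mono 0 1 2 a b c) = (a + b + c)%N by rewrite !mdegD !mdegMn !mdeg1 !mul1n.
have D u a b c := cf_Dirac k u a b c.
rewrite /kvec /= e1 e2 e3 in D.
have sol_of u : Mn k n u <-> dirac_sol t1 t2 t3 n (pauli1 R) (pauli2 R) (pauli3 R) (fun a b c => cf u (mono 0 1 2 a b c)).
  split=> [[/is_homog_mcoeff h1 [/is_homog_mcoeff h2 dz]]|[h1 h2]].
    split=> a b c; last by rewrite -D dz cf_vzero.
    rewrite -md => ne; apply/colP => j; rewrite cfE mxE.
    by case: ifP => _; [apply: h1|apply: h2].
  have h m : mdeg m <> n -> cf u m = 0.
    by rewrite (mono_surj m) md; apply: h1.
  split; last split.
  - by apply/is_homog_mcoeff => m /h /colP/(_ 0); rewrite cfE mxE.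
  - by apply/is_homog_mcoeff => m /h /colP/(_ 1); rewrite cfE mxE.
  by apply: cf_inj => m; rewrite (mono_surj m) D h2 cf_vzero.
split=> // w sol.
have e a b c : cf (of_coef n w) (mono 0 1 2 a b c) = w a b c by apply: cf_of_coef; case: sol.
exists (of_coef n w) => //; apply/sol_of; apply: dirac_sol_ext sol => a b c; by rewrite e.
Qed.

Hypotheses (o1 : odd t1) (o2 : odd t2) (o3 : odd t3) (ev : ~~ odd n) (le : (t1 + t2 + t3 <= n)%N).

Lemma Mn_lin c u v : Mn k n u -> Mn k n v -> Mn k n (vadd (vscale c u) v).
Proof.
have [h _] := coef_data012; move=> /h hu /h hv; apply/h.
by apply: dirac_sol_ext (dirac_sol_lin c hu hv) => a b d; rewrite cf_vadd cf_vscale.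
Qed.

(** Stronger than [quot_iso]: each value is attained inside the two other submodules, as needed for
    the direct sums in (v) to (vii). *)
Definition quotient_hom (i j l : 'I_3) (ti tj tl : nat) (W : bimod R) :=
  exists f : V -> 'cV[C]_(bdim (dsum W W)), [/\ bi_hom k (Mn k n) f,
    forall u, Mn k n u -> f u = 0 <-> Mnx k n i ti u
    & forall w, exists u, [/\ Mn k n u, Mnx k n j tj u, Mnx k n l tl u & f u = w]].

Lemma pauli13 : pauli1 R *m pauli3 R = - 'i *: pauli2 R.
Proof. exact: (pauli_swap (@sqr_imag R) (pauli33 R) (pauli11 R) (pauli22 R) (pauli31 R)). Qed.
Lemma pauli21 : pauli2 R *m pauli1 R = - 'i *: pauli3 R.
Proof. exact: (pauli_swap (@sqr_imag R) (pauli11 R) (pauli22 R) (pauli33 R) (pauli12 R)). Qed.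
Lemma pauli32 : pauli3 R *m pauli2 R = - 'i *: pauli1 R.
Proof. exact: (pauli_swap (@sqr_imag R) (pauli22 R) (pauli33 R) (pauli11 R) (pauli23 R)). Qed.
Lemma sqr_opp_imag : (- 'i) * (- 'i) = -1 :> C.
Proof. by rewrite mulrNN sqr_imag. Qed.

Lemma cf_opX012 u a b c : cf (opX k u) (mono 0 1 2 a b c) = rot_coef 'i (pauli1 R) (kval t2) (kval t3) (fun b c => cf u (mono 0 1 2 a b c)) b c.
Proof.
by rewrite cf_opX /kvec /= e2 e3.
Qed.
Lemma cf_opY012 u a b c : cf (opY k u) (mono 0 1 2 a b c) = rot_coef 'i (pauli2 R) (kval t3) (kval t1) (fun c a => cf u (mono 0 1 2 a b c)) c a.
Proof.
by rewrite mono_rot cf_opY /kvec /= e1 e3; apply: rot_coef_ext => c' a'; rewrite -mono_rot.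
Qed.
Lemma cf_opZ012 u a b c : cf (opZ k u) (mono 0 1 2 a b c) = rot_coef 'i (pauli3 R) (kval t1) (kval t2) (fun a b => cf u (mono 0 1 2 a b c)) a b.
Proof.
by rewrite -mono_rot cf_opZ /kvec /= e1 e2; apply: rot_coef_ext => a' b'; rewrite mono_rot.
Qed.

Lemma quotient_A : quotient_hom 0 1 2 t1 t2 t3
  (Omod t1.-1 (k_top (kval t1) (kval t2) (kval t3) n%:R) (kval t3) (kval t2)).
Proof.
have [sol ex] := coef_data012.
have pqr : [/\ (0 : 'I_3) != 1, (1 : 'I_3) != 2 & (0 : 'I_3) != 2] by [].
have [iso _] := A_iso R o1 o2 o3 ev le.
have gh u (Mu : Mn k n u) := quotient_coord o1 o2 o3 ev le (pauli11 R) (pauli22 R) (pauli33 R) (@sqr_imag R)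
  (pauli12 R) (pauli23 R) (pauli31 R) sol cf_opX012 cf_opY012 cf_opZ012 Mu.
have ker := quotient_kernel o1 o2 o3 ev le (pauli22 R) (pauli33 R) (@sqr_imag R) pqr sol.
have surj := quotient_surj o1 o2 o3 ev le (pauli11 R) (pauli33 R) (@sqr_imag R) pqr sol ex.
have gl := seg_coord_lin n 0 1 2 t1 t3 (pauli3 R) 'i t1.-1 0.
have [f [fh fz fs]] := bi_hom_iso iso gl gh.
exists f; split=> // [u Mu|w]; first by rewrite fz; apply: ker.
have [G fG] := fs w; have [u [Mu uG uq ur]] := surj G.
by exists u; split=> //; apply: fG.
Qed.

(** With the order x2, x1, x3 the operators P, Q, R are Y, X, Z; the permutation is odd, hence
    -i. *)
Lemma quotient_B : quotient_hom 1 0 2 t2 t1 t3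
  (Omod t2.-1 (kval t3) (k_top (kval t2) (kval t1) (kval t3) n%:R) (kval t1)).
Proof.
have [sol ex] := coef_data_swap coef_data012.
have pqr : [/\ (1 : 'I_3) != 0, (0 : 'I_3) != 2 & (1 : 'I_3) != 2] by [].
have le' : (t2 + t1 + t3 <= n)%N by rewrite (addnC t2).
have [iso _] := B_iso R o2 o1 o3 ev le'.
have oP u a b c : cf (opY k u) (mono 1 0 2 a b c) = rot_coef (- 'i) (pauli2 R) (kval t1) (kval t3) (fun b c => cf u (mono 1 0 2 a b c)) b c.
  rewrite rot_coef_swap opprK mono_swap mono_rot cf_opY /kvec /= e1 e3.
  by apply: rot_coef_ext => c' b'; rewrite -mono_rot mono_swap.
have oQ u a b c : cf (opX k u) (mono 1 0 2 a b c) = rot_coef (- 'i) (pauli1 R) (kval t3) (kval t2) (fun c a => cf u (mono 1 0 2 a b c)) c a.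
  rewrite rot_coef_swap opprK mono_swap cf_opX /kvec /= e2 e3.
  by apply: rot_coef_ext => c' b'; rewrite mono_swap.
have oR u a b c : cf (opZ k u) (mono 1 0 2 a b c) = rot_coef (- 'i) (pauli3 R) (kval t2) (kval t1) (fun a b => cf u (mono 1 0 2 a b c)) a b.
  rewrite rot_coef_swap opprK mono_swap -mono_rot cf_opZ /kvec /= e1 e2.
  by apply: rot_coef_ext => c' b'; rewrite mono_rot mono_swap.
have gh0 u (Mu : Mn k n u) := quotient_coord o2 o1 o3 ev le' (pauli22 R) (pauli11 R) (pauli33 R) sqr_opp_imag
  pauli21 pauli13 pauli32 sol oP oQ oR Mu.
have ker := quotient_kernel o2 o1 o3 ev le' (pauli11 R) (pauli33 R) sqr_opp_imag pqr sol.
have surj := quotient_surj o2 o1 o3 ev le' (pauli22 R) (pauli33 R) sqr_opp_imag pqr sol ex.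
have gl := seg_coord_lin n 1 0 2 t2 t3 (pauli3 R) (- 'i) t2.-1 0.
have gh u : Mn k n u -> _ := fun Mu => let: And3 a b c := gh0 u Mu in And3 b a c.
have [f [fh fz fs]] := bi_hom_iso iso gl gh.
exists f; split=> // [u Mu|w]; first by rewrite fz; apply: ker.
have [G fG] := fs w; have [u [Mu uG uq ur]] := surj G.
by exists u; split=> //; apply: fG.
Qed.

(** With the order x3, x2, x1 the operators P, Q, R are Z, Y, X; again the permutation is odd. *)
Lemma quotient_C : quotient_hom 2 1 0 t3 t2 t1
  (Omod t3.-1 (kval t2) (kval t1) (k_top (kval t3) (kval t2) (kval t1) n%:R)).
Proof.
have [sol ex] := coef_data_swap (coef_data_rot coef_data012).
have pqr : [/\ (2 : 'I_3) != 1, (1 : 'I_3) != 0 & (2 : 'I_3) != 0] by [].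
have le' : (t3 + t2 + t1 <= n)%N by rewrite addnC addnA addnAC.
have [iso _] := C_iso R o3 o2 o1 ev le'.
have oP u a b c : cf (opZ k u) (mono 2 1 0 a b c) = rot_coef (- 'i) (pauli3 R) (kval t2) (kval t1) (fun b c => cf u (mono 2 1 0 a b c)) b c.
  rewrite rot_coef_swap opprK mono_rev -mono_rot cf_opZ /kvec /= e1 e2.
  by apply: rot_coef_ext => c' b'; rewrite mono_rot mono_rev.
have oQ u a b c : cf (opY k u) (mono 2 1 0 a b c) = rot_coef (- 'i) (pauli2 R) (kval t1) (kval t3) (fun c a => cf u (mono 2 1 0 a b c)) c a.
  rewrite rot_coef_swap opprK mono_rev mono_rot cf_opY /kvec /= e1 e3.
  by apply: rot_coef_ext => c' b'; rewrite -mono_rot mono_rev.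
have oR u a b c : cf (opX k u) (mono 2 1 0 a b c) = rot_coef (- 'i) (pauli1 R) (kval t3) (kval t2) (fun a b => cf u (mono 2 1 0 a b c)) a b.
  rewrite rot_coef_swap opprK mono_rev cf_opX /kvec /= e2 e3.
  by apply: rot_coef_ext => c' b'; rewrite mono_rev.
have gh0 u (Mu : Mn k n u) := quotient_coord o3 o2 o1 ev le' (pauli33 R) (pauli22 R) (pauli11 R) sqr_opp_imag
  pauli32 pauli21 pauli13 sol oP oQ oR Mu.
have ker := quotient_kernel o3 o2 o1 ev le' (pauli22 R) (pauli11 R) sqr_opp_imag pqr sol.
have surj := quotient_surj o3 o2 o1 ev le' (pauli33 R) (pauli11 R) sqr_opp_imag pqr sol ex.
have gl := seg_coord_lin n 2 1 0 t3 t1 (pauli1 R) (- 'i) t3.-1 0.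
have gh u : Mn k n u -> _ := fun Mu => let: And3 a b c := gh0 u Mu in And3 c b a.
have [f [fh fz fs]] := bi_hom_iso iso gl gh.
exists f; split=> // [u Mu|w]; first by rewrite fz; apply: ker.
have [G fG] := fs w; have [u [Mu uG uq ur]] := surj G.
by exists u; split=> //; apply: fG.
Qed.

Lemma quotient_W : quot_iso k (fun u => Mnx k n 0 t1 u /\ Mnx k n 1 t2 u /\ Mnx k n 2 t3 u)
  (fun u => u = vzero R)
  (let N := (n%:R + 1) / 2 : C in
   let W := Emod (n - (t1 + t2 + t3)) (kval t1 + N) (kval t2 + N) (kval t3 + N) in dsum W W).
Proof.
have [sol ex] := coef_data012.
have pqr : [/\ (0 : 'I_3) != 1, (1 : 'I_3) != 2 & (0 : 'I_3) != 2] by [].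
have [iso _] := W0_iso R o1 o2 o3 ev le.
have gh u (Mu : Mnx k n 0 t1 u /\ Mnx k n 1 t2 u /\ Mnx k n 2 t3 u) :=
  sub_coord o1 o2 o3 ev le (pauli11 R) (pauli22 R) (pauli33 R) (@sqr_imag R)
  (pauli12 R) (pauli23 R) (pauli31 R) pqr sol cf_opX012 cf_opY012 cf_opZ012 Mu.1 Mu.2.1 Mu.2.2.
have gl := seg_coord_lin n 0 1 2 t1 t3 (pauli3 R) 'i (n - (t1 + t2 + t3)) t1.
have [f [[fl fh] fz fs]] := bi_hom_iso iso gl gh.
exists f; split=> // [w|u [h1 [h2 h3]]]; last first.
  by rewrite fz; apply: (sub_kernel o1 o2 o3 ev le (pauli33 R) (@sqr_imag R) pqr sol).
have [G fG] := fs w.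
have [u [h1 h2 h3 uG]] := sub_surj o1 o2 o3 ev le (pauli11 R) (pauli22 R) (pauli33 R) (@sqr_imag R) pqr sol ex G.
by exists u; split=> //; apply: fG.
Qed.

Lemma quotient_hom_iso i j l ti tj tl W : quotient_hom i j l ti tj tl W ->
  quot_iso k (Mn k n) (Mnx k n i ti) (dsum W W).
Proof.
move=> [f [[fl fh] fz fs]]; exists f; split=> // w.
by have [u [Mu _ _ e]] := fs w; exists u.
Qed.

Lemma quotient_hom_sym i j l ti tj tl W : quotient_hom i j l ti tj tl W ->
  quotient_hom i l j ti tl tj W.
Proof.
move=> [f [fh fz fs]]; exists f; split=> // w.
by have [u [Mu uj ul e]] := fs w; exists u.
Qed.

Lemma Mnx_lin i t c u v : Mnx k n i t u -> Mnx k n i t v -> Mnx k n i t (vadd (vscale c u) v).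
Proof.
move=> /Mnx_cf[Mu zu] /Mnx_cf[Mv zv]; apply/Mnx_cf; split=> [|m h]; first exact: Mn_lin.
by rewrite cf_vadd cf_vscale zu // zv // scaler0 addr0.
Qed.

(** A Chinese remainder argument. The kernels of f and f' are M_n(x_j) and M_n(x_l); each value of f
    is attained in M_n(x_i) and M_n(x_l), where f' is 0, and conversely. So the pair is onto, and
    its kernel on M_n(x_i) is the triple intersection. *)
Lemma quotient_hom_pair i j l ti tj tl W W' (S : V -> Prop) :
  (forall u, S u <-> [/\ Mnx k n i ti u, Mnx k n j tj u & Mnx k n l tl u]) ->
  quotient_hom j i l tj ti tl W -> quotient_hom l i j tl ti tj W' ->
  quot_iso k (Mnx k n i ti) S (dsum (dsum W W) (dsum W' W')).
Proof.
move=> SE [f [fh fz fs]] [f' [fh' fz' fs']].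
have sub u : Mnx k n i ti u -> Mn k n u by case.
have [hl hh] := bi_hom_dsum (bi_hom_sub sub fh) (bi_hom_sub sub fh').
exists (fun u => col_mx (f u) (f' u)); split=> // [w|u ui].
  pose w' : 'cV[C]_(bdim (dsum W W) + bdim (dsum W' W')) := w.
  have [u [Mu ui ul e]] := fs (usubmx w'); have [v [Mv vi vj e']] := fs' (dsubmx w').
  exists (vadd (vscale 1 u) v); split; first exact: Mnx_lin.
  rewrite fh.1 // fh'.1 // e e' (_ : f v = 0); last by apply/fz.
  rewrite (_ : f' u = 0); last by apply/fz'.
  by rewrite scaler0 add0r scale1r addr0 vsubmxK.
rewrite SE; split=> [h|[_ uj ul]].
  have [h1 h2] : f u = 0 /\ f' u = 0 by apply: eq_col_mx; rewrite h col_mx0.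
  by split=> //; [apply/fz => //; apply: sub|apply/fz' => //; apply: sub].
have [Mu _] := ui; rewrite (_ : f u = 0); last by apply/fz.
by rewrite (_ : f' u = 0) ?col_mx0 //; apply/fz'.
Qed.

Lemma Mnx_and3 u (i j l : 'I_3) ti tj tl : Mnx k n i ti u /\ Mnx k n j tj u /\ Mnx k n l tl u <->
  [/\ Mnx k n i ti u, Mnx k n j tj u & Mnx k n l tl u].
Proof. by split=> [[? []]|[]]. Qed.
End Main.

Lemma is_t_kval (ki : R) t : is_t ki t -> ki%:C = kval t.
Proof.
move=> [_ h]; have -> : ki = - (t%:R / 2) by rewrite -[LHS](mulKf (_ : 2 != 0)) ?pnatr_eq0 // h mulrC mulNr.
by rewrite /kval rmorphN rmorphM fmorphV !rmorph_nat.
Qed.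
End Assembly.

Theorem theorem9p16 (R : realType) (k1 k2 k3 : R) (t1 t2 t3 n : nat)
  (ht1 : is_t k1 t1) (ht2 : is_t k2 t2) (ht3 : is_t k3 t3)
  (hn_even : ~~ odd n) (hn : (t1 + t2 + t3 <= n)%N) :
  let k := kvec k1 k2 k3 in
  let K : R[i] := (k1 + k2 + k3)%:C in
  let N : R[i] := (n%:R + 1) / 2%:R in
  let Mn_ := Mn k n in
  let Mx1 := Mnx k n 0 t1 in
  let Mx2 := Mnx k n 1 t2 in
  let Mx3 := Mnx k n 2 t3 in
  let M := fun u => Mx1 u /\ Mx2 u /\ Mx3 u in
  let W0 := Emod (n - (t1 + t2 + t3)) (k1%:C + N) (k2%:C + N) (k3%:C + N) in
  let A := Omod t1.-1 (K + n.+1%:R) k3%:C k2%:C in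
  let B := Omod t2.-1 k3%:C (K + n.+1%:R) k1%:C in
  let C := Omod t3.-1 k2%:C k1%:C (K + n.+1%:R) in
  [/\ quot_iso k M (fun u => u = @vzero R) (dsum W0 W0),
      quot_iso k Mn_ Mx1 (dsum A A),
      quot_iso k Mn_ Mx2 (dsum B B),
      quot_iso k Mn_ Mx3 (dsum C C) &
      [/\ quot_iso k Mx1 M (dsum (dsum B B) (dsum C C)),
          quot_iso k Mx2 M (dsum (dsum A A) (dsum C C)) &
          quot_iso k Mx3 M (dsum (dsum A A) (dsum B B))]] /\
  [/\ bimod_irreducible W0, bimod_irreducible A,
      bimod_irreducible B & bimod_irreducible C].
Proof.
move=> k K N Mn_ Mx1 Mx2 Mx3 M W0 A B C.
have [o1 _] := ht1; have [o2 _] := ht2; have [o3 _] := ht3.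
have e1 := is_t_kval ht1; have e2 := is_t_kval ht2; have e3 := is_t_kval ht3.
have KE : K = kval R t1 + kval R t2 + kval R t3 by rewrite /K !rmorphD /= e1 e2 e3.
have AE : A = Omod t1.-1 (k_top (kval R t1) (kval R t2) (kval R t3) n%:R) (kval R t3) (kval R t2).
  by rewrite /A e2 e3 KE /k_top -natr1; congr Omod; ring.
have BE : B = Omod t2.-1 (kval R t3) (k_top (kval R t2) (kval R t1) (kval R t3) n%:R) (kval R t1).
  by rewrite /B e1 e3 KE /k_top -natr1; congr Omod; ring.
have CE : C = Omod t3.-1 (kval R t2) (kval R t1) (k_top (kval R t3) (kval R t2) (kval R t1) n%:R).
  by rewrite /C e1 e2 KE /k_top -natr1; congr Omod; ring.
have WE : W0 = Emod (n - (t1 + t2 + t3)) (kval R t1 + N) (kval R t2 + N) (kval R t3 + N).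
  by rewrite /W0 e1 e2 e3.
have hA := quotient_A e1 e2 e3 o1 o2 o3 hn_even hn.
have hB := quotient_B e1 e2 e3 o1 o2 o3 hn_even hn.
have hC := quotient_C e1 e2 e3 o1 o2 o3 hn_even hn.
have hW := quotient_W e1 e2 e3 o1 o2 o3 hn_even hn.
rewrite -AE in hA; rewrite -BE in hB; rewrite -CE in hC.
have le2 : (t2 + t1 + t3 <= n)%N by rewrite (addnC t2).
have le3 : (t3 + t2 + t1 <= n)%N by rewrite addnC addnA addnAC.
split; last first.
  split; rewrite ?WE ?AE ?BE ?CE.
  - exact: (W0_iso R o1 o2 o3 hn_even hn).2.
  - exact: (A_iso R o1 o2 o3 hn_even hn).2.
  - exact: (B_iso R o2 o1 o3 hn_even le2).2.
  - exact: (C_iso R o3 o2 o1 hn_even le3).2.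
split; first by rewrite WE.
- exact: quotient_hom_iso hA.
- exact: quotient_hom_iso hB.
- exact: quotient_hom_iso hC.
split.
- apply: (quotient_hom_pair e1 e2 e3 _ hB (quotient_hom_sym hC)) => u; exact: Mnx_and3.
- apply: (quotient_hom_pair e1 e2 e3 _ hA hC) => u; rewrite -Mnx_and3 /M /Mx1 /Mx2 /Mx3; tauto.
apply: (quotient_hom_pair e1 e2 e3 _ (quotient_hom_sym hA) (quotient_hom_sym hB)) => u.
by rewrite -Mnx_and3 /M /Mx1 /Mx2 /Mx3; tauto.
Qed.
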